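(* Let $X$, $Y$ be Banach spaces, let $\mathcal{A}\subset B_{Y^*}$ with $\overline{\operatorname{conv}}^{w^*}(\mathcal{A})=B_{Y^*}$ and let $\mathcal{B}\subset B_X$ with $\overline{\operatorname{aconv}}(\mathcal{B})=B_X$. For $y^*\in B_{Y^*}$ and $\varepsilon>0$ write $S(y^*,\varepsilon)=\{x\in S_X:\operatorname{Re}y^*(Gx)>1-\varepsilon\}$. Then the following assertions are equivalent for a norm-one operator $G\in L(X,Y)$: (i) $G$ is lush. (ii) For every $x_0\in\mathcal{B}$, $y\in S_Y$ and $\varepsilon>0$ there is $F\subset B_X$ such that $\operatorname{conv}(F)\subset\{x\in B_X:\|Gx+y\|>2-\varepsilon\}$ and $\operatorname{dist}(x_0,\operatorname{aconv}(F))<\varepsilon$. (iii) For every $x_0\in\mathcal{B}$, $y\in S_Y$ and $\varepsilon>0$ there exists $y^*\in\mathcal{A}$ with $\operatorname{Re}y^*(y)>1-\varepsilon$ such that $\operatorname{dist}\bigl(x_0,\operatorname{aconv}(S(y^*,\varepsilon))\bigr)<\varepsilon$. (iv) For every $x_0\in\mathcal{B}$, the set $\{y^*\in\operatorname{ext}B_{Y^*}: x_0\in\overline{\operatorname{aconv}}(S(y^*,\varepsilon))\text{ for every }\varepsilon>0\}$ is a dense $G_\delta$ subset of $(\operatorname{ext}B_{Y^*},w^* )$. (v) For every $x_0\in\mathcal{B}$, every $y\in S_Y$ and every $\varepsilon>0$, there exists $y^*\in\operatorname{ext}(B_{Y^*})$ such that $\operatorname{Re}y^*(y)>1-\varepsilon$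 and $x_0\in\overline{\operatorname{aconv}}(S(y^*,\varepsilon))$. (vi) For all separable subspaces $X_0\subset X$ and $Y_0\subset Y$ there are separable subspaces $X_0\subset X_\infty\subset X$ and $Y_0\subset Y_\infty\subset Y$ such that $G(X_\infty)\subset Y_\infty$, $\|G|_{X_\infty}\|=1$ and $G|_{X_\infty}:X_\infty\to Y_\infty$ is lush.
   Context: Scalars are $\mathbb{K}=\mathbb{R}$ or $\mathbb{C}$; $\mathbb{T}=\{\omega\in\mathbb{K}:|\omega|=1\}$; subspaces are closed; $B_X$, $S_X$ are the closed unit ball and unit sphere; $\operatorname{ext}$ denotes the set of extreme points; $\operatorname{aconv}(F)=\operatorname{conv}(\mathbb{T}F)$ and $\overline{\operatorname{aconv}}$ is its norm closure. Lush operator: a norm-one $G\in L(X,Y)$ is lush if for every $x_0\in B_X$, every $\varepsilon>0$ and every $y\in S_Y$ there is $F\subset B_X$ such that $\operatorname{conv}(F)\subset\{x\in B_X:\|Gx+y\|>2-\varepsilon\}$ and $\operatorname{dist}(x_0,\operatorname{aconv}(F))<\varepsilon$. *)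

(* Defs.v *)
From HB Require Import structures.
From mathcomp Require Import all_boot all_order all_algebra.
From mathcomp Require Import all_classical all_reals all_analysis.
From mathcomp Require Import complex.

Set Implicit Arguments.
Unset Strict Implicit.
Unset Printing Implicit Defensive.

Import Order.TTheory GRing.Theory Num.Theory.
Import numFieldNormedType.Exports.

Local Open Scope classical_set_scope.
Local Open Scope ring_scope.

Variant scalars := RealScalars | ComplexScalars.

Definition scalar_field (R : realType) (k : scalars) : numFieldType :=
  match k with RealScalars => R | ComplexScalars => R[i] end.

Definition re_part (R : realType) (k : scalars) : scalar_field R k -> R :=
  match k return scalar_field R k -> R with
  | RealScalars => fun x => x
  | ComplexScalars => @complex.Re R
  end.
Arguments re_part {R k} _.

Section bounded_operators.
Context {K : numFieldType} (X Y : normedModType K).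

Definition bounded_op_pred : {pred X -> Y} :=
  mem [set f : X -> Y | linear f /\ continuous f].

Lemma bounded_op_submod : submod_closed bounded_op_pred.
Proof.
split.
  rewrite inE /=; split; first by move=> a u v; rewrite /= scaler0 addr0.
  by move=> x; exact: cvg_cst.
move=> a f g; rewrite !inE /= => -[lf cf] [lg cg]; split.
  move=> b u v; rewrite !fctE lf lg.
  by rewrite !scalerDr !scalerA [b * a]mulrC addrACA.
by move=> x; apply: cvgD; [apply: cvgZr; exact: cf | exact: cg].
Qed.

HB.instance Definition _ :=
  GRing.isSubmodClosed.Build K (X -> Y) bounded_op_pred bounded_op_submod.

Record bounded_op : Type := BoundedOp
  { bounded_op_fun :> X -> Y ; _ : bounded_op_fun \in bounded_op_pred }.

HB.instance Definition _ := [isSub of bounded_op for bounded_op_fun].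
HB.instance Definition _ := [Choice of bounded_op by <:].
HB.instance Definition _ := [SubChoice_isSubLmodule of bounded_op by <:].

End bounded_operators.
Arguments bounded_op_pred {K} X Y.

Definition dual (K : numFieldType) (Y : normedModType K) := bounded_op Y K^o.

Definition weak_star (K : numFieldType) (Y : normedModType K) :=
  initial_topology (fun f : dual Y => (f : Y -> K^o) : {ptws Y -> K^o}).

HB.instance Definition _ (K : numFieldType) (Y : normedModType K) :=
  Topological.on (weak_star Y).

Section closed_subspaces.
Context {K : numFieldType} (X : normedModType K).

Record closed_subspace := ClosedSubspace {
  subspace_set :> set X ;
  subspace_submod : submod_closed (mem subspace_set) ;
  subspace_closed : closed subspace_set }.

Definition subspace_pred (U : closed_subspace) : {pred X} := mem (U : set X).

HB.instance Definition _ (U : closed_subspace) :=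
  GRing.isSubmodClosed.Build K X (subspace_pred U) (subspace_submod U).

Record subspace_type (U : closed_subspace) : Type := SubspaceType
  { subspace_val :> X ; _ : subspace_val \in subspace_pred U }.

Section instances.
Context (U : closed_subspace).

HB.instance Definition _ := [isSub of subspace_type U for @subspace_val U].
HB.instance Definition _ := [Choice of subspace_type U by <:].
HB.instance Definition _ := [SubChoice_isSubLmodule of subspace_type U by <:].

Let norm (x : subspace_type U) : K := `|val x|.

Let ler_normD x y : norm (x + y) <= norm x + norm y.
Proof. by rewrite /norm raddfD ler_normD. Qed.

Let normrZ (l : K) x : norm (l *: x) = `|l| * norm x.
Proof. by rewrite /norm linearZ normrZ. Qed.

Let normr0_eq0 x : norm x = 0 -> x = 0.
Proof. by move=> /normr0_eq0 x0; apply: val_inj; rewrite x0 raddf0. Qed.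

HB.instance Definition _ :=
  Lmodule_isNormed.Build K (subspace_type U) ler_normD normrZ normr0_eq0.

End instances.
End closed_subspaces.

Definition separable_space (T : topologicalType) :=
  exists2 D : set T, countable D & dense D.

Section restriction.
Context {K : numFieldType} {X Y : normedModType K} (G : bounded_op X Y).
Context {U : closed_subspace X} {V : closed_subspace Y}.
Context (GUV : G @` U `<=` V).

Let restrict_mem (x : subspace_type U) : G (val x) \in subspace_pred V.
Proof. by rewrite inE; apply: GUV; exists (val x) => //; apply/set_mem/(valP x). Qed.

Definition restrict_fun (x : subspace_type U) : subspace_type V :=
  SubspaceType (restrict_mem x).

Let restrict_bounded : restrict_fun \in bounded_op_pred (subspace_type U) (subspace_type V).
Proof.
have := valP G; rewrite !inE /= => -[lG cG]; split.
  move=> a u v; apply: val_inj; exact: lG.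
move=> x; apply/(@cvgrPdist_lt _ _ _ (nbhs x) _ restrict_fun (restrict_fun x)) => e e0.
have /cvgrPdist_lt /(_ e e0) /nbhs_ballP [d /= d0 dG] := cG (val x).
apply/nbhs_ballP; exists d => //= z xz.
apply: dG; move: xz; rewrite -!ball_normE /=.
exact.
Qed.

Definition restrict_op : bounded_op (subspace_type U) (subspace_type V) :=
  BoundedOp restrict_bounded.

End restriction.

Section hulls.
Context {K : numFieldType} {V : lmodType K}.

(* [convex_set] uses coefficients [t : K] with [0 <= t <= 1]; over the complex
   numbers such a [t] is real, so this is the usual (real) convex hull. *)
Definition conv_hull (A : set V) : set V :=
  smallest (@convex_set K V) A.

Definition aconv (A : set V) : set V :=
  conv_hull [set z | exists w x, [/\ `|w| = 1 :> K, A x & z = w *: x]].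

Definition extreme_points (C : set V) : set V :=
  [set x | C x /\ forall (y z : V) (t : K), C y -> C z -> 0 < t < 1 ->
                     x = t *: y + (1 - t) *: z -> y = x /\ z = x].

End hulls.

Definition unit_ball (K : numFieldType) (X : normedModType K) : set X :=
  [set x | `|x| <= 1].

Definition unit_sphere (K : numFieldType) (X : normedModType K) : set X :=
  [set x | `|x| = 1].

Arguments unit_ball {K} X.
Arguments unit_sphere {K} X.

Section lushness.
Context {R : realType} {k : scalars}.
Local Notation K := (scalar_field R k).
Implicit Types X Y : normedModType K.

(* Norms of normed modules over [K] are [K]-valued (nonnegative, hence real);
   [nrm] is the same norm with values in [R]. *)
Definition nrm X (x : X) : R := re_part `|x|.

(* [ereal_inf set0 = +oo], so no point is close to the empty set. *)
Definition set_dist X (x : X) (A : set X) : \bar R :=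
  ereal_inf [set (nrm (x - a))%:E | a in A].

(* The supremum is over a nonempty bounded set because [G] is continuous. *)
Definition opnorm X Y (G : bounded_op X Y) : R :=
  sup [set nrm (G x) | x in unit_ball X].

Definition dual_ball Y : set (dual Y) := [set f | opnorm f <= 1].

Definition near_max X Y (G : bounded_op X Y) (y : Y) (e : R) : set X :=
  [set x | unit_ball X x /\ 2 - e < nrm (G x + y)].

Definition lush X Y (G : bounded_op X Y) : Prop :=
  opnorm G = 1 /\
  forall (x0 : X) (e : R) (y : Y), unit_ball X x0 -> 0 < e -> unit_sphere Y y ->
    exists F : set X, [/\ F `<=` unit_ball X, conv_hull F `<=` near_max G y e &
                          (set_dist x0 (aconv F) < e%:E)%E].

Definition op_slice X Y (G : bounded_op X Y) (f : dual Y) (e : R) : set X :=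
  [set x | unit_sphere X x /\ 1 - e < re_part (f (G x))].

End lushness.
Arguments dual_ball {R k} Y.

(* Main.v *)
Require Import Defs.
From HB Require Import structures.
From mathcomp Require Import all_boot all_order all_algebra.
From mathcomp Require Import all_classical all_reals all_analysis.
From mathcomp Require Import borel_hierarchy complex.
From mathcomp Require Import ring lra.

(* Idea.  Real parts determine functionals and the weak-star topology, so the
   argument is carried out with [re_part] and real coefficients, uniformly in
   the two scalar fields.

   (ii) => (iii) works for any set [A] that norms [Y]: if [u] is a convex
   combination of [F] and [f (G u + y)] is close to [2], then most of the weight
   of the combination sits in the slice of [f].  As (ii) does not mention [A],
   (iii) may be used with the extreme points of the dual ball.  For fixed [x0],
   the functionals whose slice has absolute convex hull close to [x0] form a
   weak-star open set; by (iii) it meets all slices, so by Choquet's lemma it is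
   dense among the extreme points, and these form a Baire space.  This gives
   (iv), and it also gives a single slice that serves finitely many points of
   [B] at once, hence (i).  The condition (v) implies (ii) by taking [F] to be a
   slice.  For (vi), a countable set is closed off under choosing finite
   witnesses of lushness.

   The facts on extreme points (Krein-Milman, Baire) come from one lemma of
   Leger: a proper relatively open convex subset of the dual ball misses an
   extreme point. *)

Set Implicit Arguments.
Unset Strict Implicit.
Unset Printing Implicit Defensive.

Import Order.TTheory GRing.Theory Num.Theory.
Import numFieldNormedType.Exports.

Local Open Scope classical_set_scope.
Local Open Scope ring_scope.

(** * Real and complex scalars, treated alike through real parts *)

Definition scal {R : realType} {k : scalars} : R -> scalar_field R k :=
  match k return R -> scalar_field R k with
  | RealScalars => fun r => r
  | ComplexScalars => fun r => r%:C%C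
  end.

Lemma sqrt_sum_sq_le (R : rcfType) (a b : R) :
  Num.sqrt (a ^+ 2 + b ^+ 2) <= `|a| + `|b|.
Proof.
rewrite -[leRHS]ger0_norm ?addr_ge0// -[leRHS]sqrtr_sqr ler_wsqrtr // sqrrD.
by rewrite !real_normK ?num_real // lerD2r lerDl mulrn_wge0 ?mulr_ge0.
Qed.

Section scalars.
Context {R : realType} {k : scalars}.
Local Notation K := (scalar_field R k).

Fact scal_zmod : zmod_morphism (@scal R k).
Proof. by case: k => a b //; rewrite /scal rmorphB. Qed.

Fact scal_monoid : monoid_morphism (@scal R k).
Proof. by case: k; split => // a b; rewrite /scal rmorphM. Qed.

HB.instance Definition _ := GRing.isZmodMorphism.Build R K scal scal_zmod.
HB.instance Definition _ := GRing.isMonoidMorphism.Build R K scal scal_monoid.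

Fact re_part_zmod : zmod_morphism (@re_part R k).
Proof. by case: k => // -[a b] [c d]. Qed.

HB.instance Definition _ :=
  GRing.isZmodMorphism.Build K R (@re_part R k) re_part_zmod.

Lemma re_scal (r : R) : re_part (scal r : K) = r.
Proof. by case: k. Qed.

Lemma re_scalM (r : R) (z : K) : re_part (scal r * z) = r * re_part z.
Proof.
by move: z; rewrite /scal; case: k => //= -[a b] /=; rewrite mul0r subr0.
Qed.

Lemma ge0_scal (z : K) : 0 <= z -> z = scal (re_part z).
Proof.
move: z; rewrite /scal; case: k => //= -[a b]; rewrite lecE /= => /andP[/eqP -> _].
by [].
Qed.

Lemma scal_le (a b : R) : (scal a <= scal b :> K) = (a <= b).
Proof. by rewrite /scal; case: k => //; rewrite lecR. Qed.

Lemma scal_lt (a b : R) : (scal a < scal b :> K) = (a < b).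
Proof. by rewrite /scal; case: k => //; rewrite ltcR. Qed.

Lemma scal_inj : injective (@scal R k).
Proof. by move=> a b /(congr1 re_part); rewrite !re_scal. Qed.

Lemma re_part_le (x y : K) : x <= y -> re_part x <= re_part y.
Proof. by move: x y; case: k => //= x y; rewrite lecE => /andP[]. Qed.

Lemma norm_scal (r : R) : `|scal r : K| = scal `|r|.
Proof.
have [r0|r0] := leP 0 r.
  by rewrite !ger0_norm // -[0](rmorph0 scal) scal_le.
by rewrite !ltr0_norm ?rmorphN // -[0](rmorph0 scal) scal_lt.
Qed.

Lemma normc_scal (z : K) : `|z| = scal (re_part `|z|).
Proof. by apply: ge0_scal. Qed.

Lemma re_le_norm (z : K) : re_part z <= re_part `|z|.
Proof.
move: z; case: k => [z|[a b]]; first exact: ler_norm.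
rewrite normc_def /=; apply: (le_trans (ler_norm a)).
by rewrite -sqrtr_sqr ler_wsqrtr // -[leLHS]addr0 lerD2l sqr_ge0.
Qed.

Lemma norm_re_le (z : K) : `|re_part z| <= re_part `|z|.
Proof.
rewrite ler_norml re_le_norm andbT lerNl -raddfN /=.
by rewrite -[in leRHS](normrN z) re_le_norm.
Qed.

(** Rotating a vector by [w] turns the modulus of a functional value into a real part, so norms can
    be bounded through real parts alone. *)
Lemma polar (z : K) : exists w : K, `|w| = 1 /\ w * z = `|z|.
Proof.
have [->|z0] := eqVneq z 0; first by exists 1; rewrite normr1 mulr0 normr0.
move: z z0; case: k => [z z0|z z0].
  exists (Num.sg z); rewrite normr_sg z0; split=> //.
  by rewrite [in RHS]normrEsg.
exists (conjc z / `|z|).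
have nz : `|z| != 0 by rewrite normr_eq0.
have e : conjc z * z = `|z| ^+ 2.
  by rewrite mulrC -sqr_normc.
split; last by rewrite mulrAC e expr2 mulfK.
by rewrite normrM normfV normr_id normcJ divff.
Qed.

(* The multiplier is [-i] over the complex numbers and [0] over the reals. *)
Lemma norm_le_re :
  exists c : K, forall z : K, re_part `|z| <= `|re_part z| + `|re_part (c * z)|.
Proof.
case: k => [|]; first by exists 0 => z; rewrite mul0r normr0 addr0.
exists (- 'i%C) => -[a b]; rewrite normc_def /=.
rewrite (_ : - 0 * a - _ = b); last by ring.
exact: sqrt_sum_sq_le.
Qed.

(** The rationals or the Gaussian rationals, enumerated by [pickle]; they are the multipliers under
    which countable sets get closed in (vi). *)
Lemma dense_scalars : exists q : nat -> K,
  forall (z : K) (e : R), 0 < e -> exists n, re_part `|z - q n| < e.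
Proof.
have ratd (a e : R) : 0 < e -> exists q : rat, `|a - ratr q| < e.
  move=> e0; have /rat_in_itvoo[q] : a < a + e by rewrite ltrDl.
  rewrite in_itv /= => /andP[aq qe]; exists q.
  by rewrite distrC gtr0_norm ?subr_gt0 // ltrBlDl.
case: k.
  exists (fun n => ratr (odflt 0 (unpickle n : option rat))) => a e /(ratd a)[q qe].
  by exists (pickle q); rewrite pickleK.
pose p n := odflt (0, 0) (unpickle n : option (rat * rat)).
exists (fun n => (ratr (p n).1 +i* ratr (p n).2)%C) => -[a b] e e0.
have e2 : 0 < e / 2 by rewrite divr_gt0.
have [u ua] := ratd a _ e2; have [v vb] := ratd b _ e2.
exists (pickle (u, v)); rewrite normc_def /p pickleK /=.
apply: (le_lt_trans (y := `|a - ratr u| + `|b - ratr v|)); last by lra.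
exact: sqrt_sum_sq_le.
Qed.

End scalars.

(** * Norms, neighbourhoods and distances with real values *)

Section real_norm.
Context {R : realType} {k : scalars}.
Local Notation K := (scalar_field R k).
Implicit Type X : normedModType K.

Lemma nrmE X (x : X) : `|x| = scal (nrm x).
Proof. exact: ge0_scal. Qed.

Lemma nrm_ge0 X (x : X) : 0 <= nrm x.
Proof. by rewrite -(scal_le (k := k)) -nrmE rmorph0. Qed.

Lemma nrm0 X : nrm (0 : X) = 0.
Proof. by rewrite /nrm normr0 raddf0. Qed.

Lemma nrm_eq0 X (x : X) : nrm x = 0 -> x = 0.
Proof. by move=> x0; apply: normr0_eq0; rewrite nrmE x0 rmorph0. Qed.

Lemma nrm_gt0 X (x : X) : x != 0 -> 0 < nrm x.
Proof.
move=> x0; rewrite lt_neqAle nrm_ge0 andbT.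
by apply: contra x0 => /eqP/esym/nrm_eq0 ->.
Qed.

Lemma nrmD X (x y : X) : nrm (x + y) <= nrm x + nrm y.
Proof. by rewrite -(scal_le (k := k)) rmorphD /= -!nrmE ler_normD. Qed.

Lemma nrmN X (x : X) : nrm (- x) = nrm x.
Proof. by rewrite /nrm normrN. Qed.

Lemma nrmB X (x y : X) : nrm (x - y) = nrm (y - x).
Proof. by rewrite -nrmN opprB. Qed.

Lemma nrm_dist X (y x z : X) : nrm (x - z) <= nrm (x - y) + nrm (y - z).
Proof. by rewrite -[x - z](subrKA y) nrmD. Qed.

Lemma nrmZ X (a : K) (x : X) : nrm (a *: x) = re_part `|a| * nrm x.
Proof. by rewrite {1}/nrm normrZ (normc_scal a) re_scalM re_scal. Qed.

Lemma nrm_scal X (t : R) (x : X) : nrm (scal t *: x) = `|t| * nrm x.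
Proof. by rewrite nrmZ norm_scal re_scal. Qed.

Lemma nrm_normalize X (x : X) : 0 < nrm x -> nrm (scal (nrm x)^-1 *: x) = 1.
Proof.
by move=> x0; rewrite nrm_scal ger0_norm ?invr_ge0 ?nrm_ge0 // mulVf ?gt_eqF.
Qed.

Lemma nrm_unim X (w : K) (x : X) : `|w| = 1 -> nrm (w *: x) = nrm x.
Proof. by move=> w1; rewrite nrmZ w1 -(rmorph1 scal) re_scal mul1r. Qed.

Lemma unit_ballE X (x : X) : unit_ball X x <-> nrm x <= 1.
Proof. by rewrite /unit_ball /= nrmE -(rmorph1 scal) scal_le. Qed.

Lemma unit_sphereE X (x : X) : unit_sphere X x <-> nrm x = 1.
Proof.
rewrite /unit_sphere /= nrmE -(rmorph1 scal); split=> [/scal_inj //|->//].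
Qed.

Lemma nbhs_nrm X (x : X) (U : set X) :
  nbhs x U <-> exists2 e : R, 0 < e & forall y, nrm (x - y) < e -> U y.
Proof.
split=> [/nbhs_ballP[e /= e0 eU]|[e e0 eU]].
  have ee : e = scal (re_part e) by apply: ge0_scal; exact: ltW.
  exists (re_part e) => [|y xy].
    by rewrite -(scal_lt (k := k)) rmorph0 -ee.
  by apply: eU; rewrite -ball_normE /= nrmE ee scal_lt.
apply/nbhs_ballP; exists (scal e); first by rewrite /= -(rmorph0 scal) scal_lt.
by move=> y; rewrite -ball_normE /= nrmE scal_lt => /eU.
Qed.

Lemma closure_nrm X (A : set X) (x : X) :
  closure A x <-> forall e : R, 0 < e -> exists2 a, A a & nrm (x - a) < e.
Proof.
split=> [cA e e0|H U /nbhs_nrm[e /H[a Aa xa] eU]].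
  have /cA[a [Aa ?]] : nbhs x [set y | nrm (x - y) < e] by apply/nbhs_nrm; exists e.
  by exists a.
by exists a; split=> //; exact: eU.
Qed.

Lemma set_dist_lt X (x : X) (A : set X) (e : R) :
  (set_dist x A < e%:E)%E <-> exists2 a, A a & nrm (x - a) < e.
Proof.
split=> [/ereal_inf_lt[_ [a Aa <-]]|[a Aa xa]].
  by rewrite lte_fin; exists a.
by apply/ereal_inf_ltP; exists (nrm (x - a))%:E => //; exists a.
Qed.

End real_norm.

(** * Convex and absolutely convex hulls *)

Section hull_theory.
Context {R : realType} {k : scalars} {V : lmodType (scalar_field R k)}.
Implicit Types A C : set V.
Local Notation K := (scalar_field R k).

Definition real_convex A := forall x y (t : R), A x -> A y -> 0 <= t -> t <= 1 ->
  A (scal t *: x + scal (1 - t) *: y).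

Lemma real_convexP A : convex_set A <-> real_convex A.
Proof.
split=> [cA x y t Ax Ay t0 t1|cA x y t /set_mem Ax /set_mem Ay].
  have s0 : (0 : K) <= scal t by rewrite -(rmorph0 scal) scal_le.
  have s1 : scal t <= (1 : K) by rewrite -(rmorph1 scal) scal_le.
  have := cA x y (Itv01 s0 s1) (mem_set Ax) (mem_set Ay).
  by move=> /set_mem; rewrite rmorphB rmorph1.
apply/mem_set; have t0 : 0 <= t%:num by [].
have t1 : t%:num <= 1 by [].
have tE := ge0_scal t0.
have -> : conv t x y =
    scal (re_part t%:num) *: x + scal (1 - re_part t%:num) *: y.
  by rewrite raddfB /= -tE [X in X - _](rmorph1 scal).
apply: cA => //.
  by have := re_part_le t0; rewrite raddf0.
by have := re_part_le t1; rewrite -(rmorph1 scal) re_scal.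
Qed.

Lemma sub_conv_hull A : A `<=` conv_hull A.
Proof. exact: sub_gen_smallest. Qed.

Lemma conv_hull_convex A : real_convex (conv_hull A).
Proof.
move=> x y t xA yA t0 t1 C CA; have [/real_convexP cC _] := CA.
exact: cC (xA _ CA) (yA _ CA) t0 t1.
Qed.

Lemma conv_hull_min A C : real_convex C -> A `<=` C -> conv_hull A `<=` C.
Proof. by move=> /real_convexP cC sAC; exact: smallest_sub. Qed.

Lemma conv_hull_mono A C : A `<=` C -> conv_hull A `<=` conv_hull C.
Proof.
move=> sAC; apply: conv_hull_min; first exact: conv_hull_convex.
by move=> x /sAC; exact: sub_conv_hull.
Qed.

Lemma aconv_mono A C : A `<=` C -> aconv A `<=` aconv C.
Proof.
move=> sAC; apply: conv_hull_mono => _ [w [x [w1 /sAC Cx ->]]].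
by exists w, x.
Qed.

(** Serves as the induction principle for absolutely convex hulls. *)
Lemma aconv_min A C : real_convex C ->
  (forall (w : K) x, `|w| = 1 -> A x -> C (w *: x)) -> aconv A `<=` C.
Proof.
by move=> cC sAC; apply: conv_hull_min => // _ [w [x [w1 Ax ->]]]; exact: sAC.
Qed.

Lemma aconv_convex A : real_convex (aconv A).
Proof. exact: conv_hull_convex. Qed.

Lemma aconv_mem A (w : K) x : `|w| = 1 -> A x -> aconv A (w *: x).
Proof. by move=> w1 Ax; apply: sub_conv_hull; exists w, x. Qed.

Lemma aconv_balanced A (w : K) x : `|w| = 1 -> aconv A x -> aconv A (w *: x).
Proof.
move=> w1; move: x; apply: aconv_min => [x y t|v x v1 Ax].
  move=> Ax Ay t0 t1; rewrite scalerDr !scalerA !(mulrC w) -!scalerA.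
  exact: aconv_convex.
by rewrite scalerA; apply: aconv_mem => //; rewrite normrM w1 v1 mulr1.
Qed.

(** Points with a finite witness form a convex set, since two witnesses can be concatenated. *)
Lemma aconv_finite A x : aconv A x ->
  exists s : seq V, (forall a, a \in s -> A a) /\ aconv [set` s] x.
Proof.
move: x; apply: aconv_min => [x y t [s [sA sx]] [s' [sA' sy]] t0 t1|w x w1 Ax].
  exists (s ++ s'); split=> [a|].
    by rewrite mem_cat => /orP[/sA|/sA'].
  apply: aconv_convex => //.
  - by apply: aconv_mono sx => a /=; rewrite mem_cat => ->.
  - by apply: aconv_mono sy => a /=; rewrite mem_cat => ->; rewrite orbT.
exists [:: x]; split=> [a|]; first by rewrite inE => /eqP ->.
by apply: aconv_mem => //=; rewrite inE.
Qed.

End hull_theory.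

(** * Bounded operators and the weak-star topology *)

Section bounded_theory.
Context {R : realType} {k : scalars} {X Y : normedModType (scalar_field R k)}.
Local Notation K := (scalar_field R k).
Implicit Type G : bounded_op X Y.

Fact bounded_op_linear G : linear G.
Proof. by have := valP G; rewrite inE => -[]. Qed.

HB.instance Definition _ G := GRing.isLinear.Build K X Y *:%R G (@bounded_op_linear G).

Lemma bounded_op_lipschitz G : exists M : R, forall x, nrm (G x) <= M * nrm x.
Proof.
have /(_ 0) : continuous G by have := valP G; rewrite inE => -[].
rewrite /continuous_at linear0 => cG.
have /cG/nbhs_nrm[e e0 eG] : nbhs (0 : Y) [set y | nrm (0 - y) < 1].
  by apply/nbhs_nrm; exists 1.
exists (2 / e) => x; have [->|x0] := eqVneq x 0;
  first by rewrite linear0 !nrm0 mulr0.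
have xp := nrm_gt0 x0.
(* This factor rescales [x] to norm [e / 2], strictly inside the ball that [G] maps into the unit
   ball. *)
have t0 : 0 < e / (2 * nrm x) by rewrite divr_gt0 // mulr_gt0.
have /eG/= : nrm (0 - scal (e / (2 * nrm x)) *: x) < e.
  rewrite sub0r nrmN nrm_scal gtr0_norm // invfM !mulrA mulfVK ?gt_eqF //.
  by rewrite ltr_pdivrMr // mulr2n mulrDr mulr1 ltrDl.
rewrite sub0r nrmN linearZ nrm_scal gtr0_norm // mulrC -ltr_pdivlMr //.
by rewrite div1r invf_div mulrAC; exact: ltW.
Qed.

Lemma opnorm_has_sup G : has_sup [set nrm (G x) | x in unit_ball X].
Proof.
split; first by exists (nrm (G 0)), 0 => //; apply/unit_ballE; rewrite nrm0.
have [M GM] := bounded_op_lipschitz G; exists `|M| => _ [x /unit_ballE x1 <-].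
rewrite (le_trans (GM x)) // (le_trans (ler_norm _)) // normrM.
by rewrite ler_piMr // ger0_norm // nrm_ge0.
Qed.

Lemma opnorm_ball G x : nrm x <= 1 -> nrm (G x) <= opnorm G.
Proof.
move=> /unit_ballE x1; apply: ub_le_sup; last by exists x.
by have [] := opnorm_has_sup G.
Qed.

Lemma opnorm_le G (c : R) : (forall x, nrm x <= 1 -> nrm (G x) <= c) -> opnorm G <= c.
Proof.
move=> Gc; apply: ge_sup; first by have [] := opnorm_has_sup G.
by move=> _ [x /unit_ballE x1 <-]; exact: Gc.
Qed.

Lemma opnorm_gt G (c : R) : c < opnorm G -> exists2 x, nrm x <= 1 & c < nrm (G x).
Proof.
move=> /(sup_gt (proj1 (opnorm_has_sup G)))[_ [x /unit_ballE x1 <-] cx].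
by exists x.
Qed.

Lemma opnorm_contraction G x : opnorm G <= 1 -> nrm (G x) <= nrm x.
Proof.
move=> G1; have [->|x0] := eqVneq x 0; first by rewrite linear0 !nrm0.
have xp := nrm_gt0 x0.
have /(opnorm_ball G) : nrm (scal (nrm x)^-1 *: x) <= 1.
  by rewrite nrm_normalize.
rewrite linearZ nrm_scal gtr0_norm ?invr_gt0 // mulrC ler_pdivrMr // => xG.
by rewrite (le_trans xG) // ler_piMl // ltW.
Qed.

End bounded_theory.

Section dual_theory.
Context {R : realType} {k : scalars} {Y : normedModType (scalar_field R k)}.
Local Notation K := (scalar_field R k).
Implicit Types f g : dual Y.

Lemma dualD f g y : (f + g) y = f y + g y. Proof. by []. Qed.

Lemma dualZ (a : K) f y : (a *: f) y = a * f y. Proof. by []. Qed.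

Lemma re_dualD f y z : re_part (f (y + z)) = re_part (f y) + re_part (f z).
Proof. by rewrite linearD raddfD. Qed.

Lemma re_dual_scal f (t : R) y : re_part (f (scal t *: y)) = t * re_part (f y).
Proof. by rewrite linearZ /= re_scalM. Qed.

Lemma re_dual_conv f g (t : R) y :
  re_part ((scal t *: f + scal (1 - t) *: g) y)
    = t * re_part (f y) + (1 - t) * re_part (g y).
Proof. by rewrite dualD !dualZ raddfD /= !re_scalM. Qed.

Lemma dual_ballP f : dual_ball Y f <-> forall y, re_part (f y) <= nrm y.
Proof.
split=> [f1 y|fy].
  by rewrite (le_trans (re_le_norm _)) //; exact: (opnorm_contraction (G := f)).
apply: (opnorm_le (G := f)) => y y1.
have [w [w1 wf]] := polar (f y).
have : re_part (f (w *: y)) = re_part `|f y| by rewrite linearZ /= -wf.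
by rewrite /nrm => <-; rewrite (le_trans (fy _)) // nrm_unim.
Qed.

Lemma dual_ball_norm f y : dual_ball Y f -> `|re_part (f y)| <= nrm y.
Proof.
move=> /dual_ballP f1; rewrite ler_norml f1 andbT.
by rewrite lerNl -raddfN -linearN -nrmN f1.
Qed.

Lemma dual_re_inj f g : (forall y, re_part (f y) = re_part (g y)) -> f = g.
Proof.
move=> fg; apply: val_inj; apply/funext => y; apply/eqP.
rewrite -subr_eq0 -normr_eq0 normc_scal.
have [c cP] := norm_le_re (R := R) (k := k).
suff -> : re_part `|f y - g y| = 0 by rewrite rmorph0.
apply/eqP; rewrite eq_le; apply/andP; split.
  rewrite (le_trans (cP _)) // raddfB /= fg subrr normr0 add0r mulrBr raddfB /=.
  have := fg (c *: y); rewrite !linearZ /= => ->; rewrite subrr normr0.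
  by [].
by rewrite -(scal_le (k := k)) -normc_scal rmorph0.
Qed.

Lemma dual_ball_convex : real_convex (dual_ball Y).
Proof.
move=> f g t /dual_ballP f1 /dual_ballP g1 t0 t1; apply/dual_ballP => y.
rewrite re_dual_conv; have -> : nrm y = t * nrm y + (1 - t) * nrm y by ring.
by rewrite lerD // ler_wpM2l // subr_ge0.
Qed.

Lemma re_eval_continuous (y : Y) :
  continuous (fun f : weak_star Y => re_part (f y) : R).
Proof.
move=> f; have FF := nbhs_filter f.
apply/(@cvgrPdist_lt _ _ _ _ FF) => e e0.
have : (fun g : weak_star Y => (g : Y -> K^o) y) @ f --> (f : Y -> K^o) y.
  apply: (@cvg_comp _ _ _ (fun g : weak_star Y => (g : {ptws Y -> K^o}))
    (fun h : {ptws Y -> K^o} => h y)).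
    exact: initial_continuous.
  exact: (@proj_continuous Y (fun=> K^o) y).
move=> /(@cvgrPdist_lt _ _ _ _ FF) /(_ (scal e)).
rewrite -[X in X < _](rmorph0 scal) scal_lt => /(_ e0).
apply: filterS => g; rewrite normc_scal scal_lt; apply: le_lt_trans.
by rewrite -raddfB norm_re_le.
Qed.

(** By [norm_le_re], the modulus of a functional at [y] is controlled by its real parts at [y] and
    at [c *: y]. *)
Lemma weak_star_cvg (F : set_system (weak_star Y)) (f : weak_star Y) : Filter F ->
  (forall y, (fun g : weak_star Y => re_part (g y) : R) @ F --> (re_part (f y) : R)) ->
  F --> f.
Proof.
move=> FF Ff.
have fF : (fun g : weak_star Y => (g : {ptws Y -> K^o})) @ F --> (f : {ptws Y -> K^o}).
  apply/pointwise_cvgP => y; apply/cvgrPdist_lt => e e0.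
  have [c cP] := norm_le_re (R := R) (k := k).
  have ee : e = scal (re_part e) by apply: ge0_scal; exact: ltW.
  have {}e0 : 0 < re_part e by rewrite -(scal_lt (k := k)) rmorph0 -ee.
  have e2 : 0 < re_part e / 2 by rewrite divr_gt0.
  have /cvgrPdist_lt/(_ _ e2) H1 := Ff y.
  have /cvgrPdist_lt/(_ _ e2) H2 := Ff (c *: y).
  apply: filterS2 H1 H2 => g /= H1 H2; rewrite ee normc_scal scal_lt.
  apply: le_lt_trans (cP _) _; rewrite raddfB mulrBr raddfB /=.
  move: H2; rewrite !linearZ /= => H2.
  by rewrite (splitr (re_part e)) ltrD.
move=> U [_ [[C oC <-] Cf CU]].
have : nbhs (f : {ptws Y -> K^o}) C by apply: open_nbhs_nbhs.
move=> /fF FC; change (F U); exact: (@filterS _ F FF _ _ CU FC).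
Qed.

(** Over the complex numbers the functional is recovered from its real part: the imaginary part of
    [f y] is the real part of [f] at [-i] times [y]. *)
Lemma dual_of_real (phi : Y -> R) :
  (forall x y, phi (x + y) = phi x + phi y) ->
  (forall (t : R) y, phi (scal t *: y) = t * phi y) ->
  (forall y, phi y <= nrm y) ->
  exists2 f : dual Y, dual_ball Y f & forall y, re_part (f y) = phi y.
Proof.
move=> phiD phiZ phi1.
suff [f [lf fphi]] : exists f : Y -> K^o, linear f /\ forall y, re_part (f y) = phi y.
  have fl y : re_part `|f y| <= nrm y.
    have [w [w1 wf]] := polar (f y).
    have fw : f (w *: y) = w * f y.
      by have := lf w y 0; rewrite addr0 => ->; have := lf (-1) 0 0;
        rewrite scaler0 addr0 scaleN1r addNr => ->; rewrite addr0.
    by rewrite -wf -fw fphi (le_trans (phi1 _)) // nrm_unim.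
  have fc : continuous f.
    move=> x; apply/cvgrPdist_lt => e e0.
    have ee : e = scal (re_part e) by apply: ge0_scal; exact: ltW.
    have {}e0 : 0 < re_part e by rewrite -(scal_lt (k := k)) rmorph0 -ee.
    apply/nbhs_nrm; exists (re_part e) => // y xy.
    have -> : f x - f y = f (x - y).
      by rewrite addrC -scaleN1r -lf scaleN1r addrC.
    by rewrite normc_scal ee scal_lt (le_lt_trans (fl _)).
  have fb : f \in bounded_op_pred Y K^o by rewrite inE.
  by exists (BoundedOp fb) => //; apply/dual_ballP => y /=; rewrite fphi.
move: (Y) phi phiD phiZ {phi1}; rewrite /scal; case: k => Z phi phiD phiZ.
  by exists phi; split=> // a x y; rewrite phiD phiZ.
have iphi y : phi (- 'i%C *: ('i%C *: y)) = phi y.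
  by rewrite scalerA mulNr -expr2 sqr_i opprK scale1r.
exists (fun y => (phi y +i* phi (- 'i%C *: y))%C); split=> //.
move=> [a b] x y.
have dec z : Complex a b *: z = a%:C%C *: z + b%:C%C *: ('i%C *: z).
  rewrite scalerA -scalerDl; congr (_ *: _); apply/eqP.
  by rewrite eq_complex /=; apply/andP; split; apply/eqP; ring.
have phiN z : phi (- z) = - phi z.
  have := phiZ (-1) z; rewrite rmorphN rmorph1 scaleN1r => ->.
  by rewrite mulN1r.
apply/eqP; rewrite eq_complex /=; apply/andP; split; apply/eqP.
  rewrite phiD dec phiD !phiZ; congr (_ + _).
  rewrite scaleNr phiN; ring.
rewrite scalerDr phiD; congr (_ + _).
rewrite scalerA mulrC -scalerA dec phiD !phiZ.
rewrite !scaleNr scalerN phiN.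
have -> : 'i%C *: ('i%C *: x) = - x by rewrite scalerA -expr2 sqr_i scaleN1r.
rewrite opprK; ring.
Qed.

End dual_theory.

(** * The Hahn-Banach theorem and compactness of the dual ball *)

Section hahn_banach.
Context {R : realType} {k : scalars} {V : lmodType (scalar_field R k)}.
Local Notation K := (scalar_field R k).
Implicit Types (p q : V -> R) (x y z : V) (t : R).

Definition sublinear p :=
  (forall x y, p (x + y) <= p x + p y) /\
  (forall t x, 0 <= t -> p (scal t *: x) = t * p x).

Lemma sublinear0 p : sublinear p -> p 0 = 0.
Proof. by move=> [_ pZ]; have := pZ 0 0 (lexx _); rewrite scaler0 mul0r. Qed.

Lemma sublinear_opp p x : sublinear p -> - p (- x) <= p x.
Proof.
move=> sp; rewrite lerNl -subr_ge0 opprK -(sublinear0 sp) -(addNr x).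
by have [pD _] := sp.
Qed.

(** Lowers [p] so that a linear minorant is forced to be at least [p z] at [z]: the choice [t = 1]
    bounds the shift at [- z] by [- p z], while [t = 0] keeps the shift below [p]. *)
Definition sublinear_shift p z x : R :=
  inf [set p (x + scal t *: z) - t * p z | t in [set t | 0 <= t]].

Lemma sublinear_shift_lb p z x t : sublinear p -> 0 <= t ->
  - p (- x) <= p (x + scal t *: z) - t * p z.
Proof.
move=> sp t0; have [pD pZ] := sp.
rewrite lerBrDr -pZ // addrC lerBlDr.
by have := pD (x + scal t *: z) (- x); rewrite addrAC subrr add0r.
Qed.

Lemma sublinear_shift_le p z x t : sublinear p -> 0 <= t ->
  sublinear_shift p z x <= p (x + scal t *: z) - t * p z.
Proof.
move=> sp t0; apply: ge_inf; last by exists t.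
by exists (- p (- x)) => _ [s s0 <-]; exact: sublinear_shift_lb.
Qed.

Lemma le_sublinear_shift p z x (c : R) :
  (forall t, 0 <= t -> c <= p (x + scal t *: z) - t * p z) ->
  c <= sublinear_shift p z x.
Proof.
move=> cp; apply: lb_le_inf; last by move=> _ [t t0 <-]; exact: cp.
by exists (p (x + scal 0 *: z) - 0 * p z), 0 => //=.
Qed.

Lemma sublinear_shift_sublinear p z : sublinear p -> sublinear (sublinear_shift p z).
Proof.
move=> sp; have [pD pZ] := sp; split=> [x y|t x].
  rewrite -lerBlDr; apply: le_sublinear_shift => t t0.
  rewrite lerBlDr -lerBlDl; apply: le_sublinear_shift => s s0.
  rewrite lerBlDl; apply: le_trans (sublinear_shift_le _ _ sp (addr_ge0 t0 s0)) _.
  have := pD (x + scal t *: z) (y + scal s *: z).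
  by rewrite addrACA -scalerDl -rmorphD /=; lra.
(* Half of homogeneity suffices: the reverse inequality is this one for [t^-1] at [scal t *: x]. *)
have half u w : 0 < u -> sublinear_shift p z (scal u *: w) <= u * sublinear_shift p z w.
  move=> u0; rewrite mulrC -ler_pdivrMr //; apply: le_sublinear_shift => s s0.
  rewrite ler_pdivrMr // mulrC mulrBr mulrA -(pZ u) ?(ltW u0) // scalerDr scalerA -rmorphM /=.
  by apply: sublinear_shift_le => //; rewrite mulr_ge0 // ltW.
rewrite le_eqVlt => /predU1P[<-|t0].
  rewrite rmorph0 scale0r mul0r; apply/eqP; rewrite eq_le; apply/andP; split.
    have := sublinear_shift_le z 0 sp (lexx 0).
    by rewrite rmorph0 scale0r mul0r addr0 subr0 (sublinear0 sp).
  apply: le_sublinear_shift => s s0.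
  by have := sublinear_shift_lb z 0 sp s0; rewrite oppr0 (sublinear0 sp) oppr0.
apply/eqP; rewrite eq_le half //=.
have := half t^-1 (scal t *: x); rewrite invr_gt0 => /(_ t0).
by rewrite scalerA -rmorphM /= mulVf ?gt_eqF // rmorph1 scale1r ler_pdivlMl.
Qed.

(** Zorn's lemma: the pointwise infimum of a chain below [p] is finite, being at least [- p (- x)],
    and is again sublinear. *)
Lemma minimal_sublinear p : sublinear p ->
  exists q, [/\ sublinear q, forall x, q x <= p x &
    forall r, sublinear r -> (forall x, r x <= q x) -> forall x, q x <= r x].
Proof.
move=> sp; pose T := {q | sublinear q /\ forall x, q x <= p x}.
have pT : sublinear p /\ forall x, p x <= p x by [].
(* The order is reversed, so that a maximal element is a minimal functional. *)
pose S (q r : T) := `[< forall x, sval r x <= sval q x >].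
have [||A totA|[q [sq qp]] qmin] := @ZL_preorder T (exist _ p pT) S.
- by move=> q; apply/asboolP.
- move=> r q s /asboolP qr /asboolP sq; apply/asboolP => x.
  exact: le_trans (sq x) (qr x).
- have [[a0 Aa0]|A0] := pselect (A !=set0); last first.
    by exists (exist _ p pT) => s As; case: A0; exists s.
  pose q x := inf [set sval a x | a in A].
  have lbq (a : T) x : - p (- x) <= sval a x.
    have [sa ap] := proj2_sig a; rewrite (le_trans _ (sublinear_opp x sa)) //.
    by rewrite lerN2.
  have q_le (a : T) x : A a -> q x <= sval a x.
    move=> Aa; apply: ge_inf; last by exists a.
    by exists (- p (- x)) => _ [b _ <-].
  have le_q x c : (forall a, A a -> c <= sval a x) -> c <= q x.
    move=> ca; apply: lb_le_inf; first by exists (sval a0 x), a0.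
    by move=> _ [a Aa <-]; exact: ca.
  have sq : sublinear q.
    split=> [x y|t x t0].
      rewrite -lerBlDr; apply: (le_q) => a Aa.
      rewrite lerBlDr -lerBlDl; apply: (le_q) => b Ab; rewrite lerBlDl.
      (* In a chain the smaller of the two functionals can be used at both points, which gives
         subadditivity of the infimum. *)
      wlog ab : a b x y Aa Ab / forall z, sval a z <= sval b z.
        move=> H; have [/asboolP ba|/asboolP ab] := totA _ _ Aa Ab.
          by rewrite addrC [leRHS]addrC; exact: H.
        exact: H.
      have [[aD _] _] := proj2_sig a.
      by rewrite (le_trans (q_le _ _ Aa)) // (le_trans (aD _ _)) // lerD2l.
    move: t0; rewrite le_eqVlt => /predU1P[<-|t0].
      rewrite rmorph0 scale0r mul0r.
      have a00 (a : T) : sval a 0 = 0 by have [sa _] := proj2_sig a; exact: sublinear0.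
      apply/eqP; rewrite eq_le; apply/andP; split.
        by rewrite -(a00 a0) q_le.
      by apply: (le_q) => a _; rewrite a00.
    apply/eqP; rewrite eq_le; apply/andP; split.
      rewrite mulrC -ler_pdivrMr //; apply: (le_q) => a Aa.
      have [[_ aZ] _] := proj2_sig a.
      by rewrite ler_pdivrMr // mulrC -aZ ?(ltW t0) // q_le.
    apply: (le_q) => a Aa; have [[_ aZ] _] := proj2_sig a.
    by rewrite aZ ?(ltW t0) // ler_wpM2l ?(ltW t0) // q_le.
  have qp x : q x <= p x.
    by rewrite (le_trans (q_le _ _ Aa0)) //; have [_ ->] := proj2_sig a0.
  exists (exist _ q (conj sq qp)) => a Aa; apply/asboolP => x /=; exact: q_le.
exists q; split=> // r sr rq.
have rp x : r x <= p x by exact: le_trans (rq x) (qp x).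
by have /asboolP := qmin (exist _ r (conj sr rp)) (introT (asboolP _) rq).
Qed.

(* A minimal sublinear functional [q] is linear, because it cannot be lowered
   by its shift in the direction [z], which gives [q x + q z <= q (x + z)]. *)
Lemma hahn_banach p : sublinear p ->
  exists phi : V -> R, [/\ forall x y, phi (x + y) = phi x + phi y,
    forall t x, phi (scal t *: x) = t * phi x & forall x, phi x <= p x].
Proof.
move=> /minimal_sublinear[q [sq qp qmin]]; have [qD qZ] := sq.
have qA x y : q (x + y) = q x + q y.
  apply/eqP; rewrite eq_le qD /=.
  have /(_ x) : forall x, q x <= sublinear_shift q y x.
    apply: qmin; first exact: sublinear_shift_sublinear.
    move=> z; have := sublinear_shift_le y z sq (lexx 0).
    by rewrite rmorph0 scale0r addr0 mul0r subr0.
  move=> /le_trans/(_ (sublinear_shift_le _ _ sq ler01)).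
  by rewrite rmorph1 scale1r mul1r lerBrDr.
have qN x : q (- x) = - q x.
  by apply/eqP; rewrite -addr_eq0 -qA addNr (sublinear0 sq).
exists q; split=> // t x; have [t0|t0] := leP 0 t; first exact: qZ.
have := qZ (- t) x; rewrite oppr_ge0 => /(_ (ltW t0)).
by rewrite rmorphN scaleNr qN mulNr => /oppr_inj.
Qed.

End hahn_banach.

Lemma fmap_ultra {T U : Type} (f : T -> U) (F : set_system T) :
  UltraFilter F -> UltraFilter (f @ F).
Proof.
move=> UF; have PF : ProperFilter F by exact: ultra_proper.
split=> [|G PG FG]; first exact: fmap_proper_filter.
apply/seteqP; split=> [A GA|//].
have [//|FA] := in_ultra_setVsetC (f @^-1` A) UF.
have GA' : G (~` A) := FG _ FA.
by case: (@filter_not_empty _ G _); rewrite -(setICr A); exact: filterI.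
Qed.

Section dual_ball_compactness.
Context {R : realType} {k : scalars} {Y : normedModType (scalar_field R k)}.
Local Notation K := (scalar_field R k).

(** A linear minorant of the norm shifted in the direction [y] must attain the norm at [y]. *)
Lemma norming_functional (y : Y) : exists2 f : dual Y,
  dual_ball Y f & re_part (f y) = nrm y.
Proof.
have sn : sublinear (fun x : Y => nrm x).
  by split=> [x z|t x t0]; [exact: nrmD|rewrite nrm_scal ger0_norm].
have [phi [phiD phiZ phile]] := hahn_banach (sublinear_shift_sublinear y sn).
have phi1 z : phi z <= nrm z.
  apply: (le_trans (phile _)); have := sublinear_shift_le y z sn (lexx 0).
  by rewrite rmorph0 scale0r addr0 mul0r subr0.
have [f f1 fphi] := dual_of_real phiD phiZ phi1.
exists f => //; apply/eqP; rewrite eq_le; move/dual_ballP : (f1) => -> /=.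
have := le_trans (phile (- y)) (sublinear_shift_le y (- y) sn ler01).
rewrite rmorph1 scale1r addNr nrm0 sub0r mul1r -fphi linearN raddfN /=.
by rewrite lerN2.
Qed.

(** Along an ultrafilter each evaluation stays in a compact segment and converges; the limits
    inherit real linearity and the bound by the norm, so they form the real part of a functional in
    the ball. *)
Lemma dual_ball_compact : compact (dual_ball Y : set (weak_star Y)).
Proof.
rewrite compact_ultra => F UF FB.
have PF : ProperFilter F by exact: ultra_proper.
have ev y : exists c : R, c <= nrm y /\
    (fun g : weak_star Y => re_part (g y) : R) @ F --> c.
  have := @segment_compact R (- nrm y) (nrm y); rewrite compact_ultra.
  have UG := fmap_ultra (fun g : weak_star Y => re_part (g y) : R) UF.
  move=> /(_ _ UG) [].
    apply: (@filterS _ F _ _ _ _ FB) => g g1.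
    by have := dual_ball_norm y g1; rewrite ler_norml /= in_itv.
  move=> c [/=]; rewrite in_itv /= => /andP[_ cy] Fc; by exists c.
have [phi phiP] := choice ev.
have [f f1 fphi] : exists2 f : dual Y, dual_ball Y f & forall y, re_part (f y) = phi y.
  apply: dual_of_real => [x y|t y|y]; last by have [] := phiP y.
    have [_ c1] := phiP (x + y); have [_ c2] := phiP x; have [_ c3] := phiP y.
    have E : (fun g : weak_star Y => re_part (g (x + y)) : R) =
        (fun g => re_part (g x)) \+ (fun g => re_part (g y)).
      by apply/funext => g; exact: re_dualD.
    by rewrite E in c1; exact: cvg_unique c1 (cvgD c2 c3).
  have [_ c1] := phiP (scal t *: y); have [_ c2] := phiP y.
  have E : (fun g : weak_star Y => re_part (g (scal t *: y)) : R) =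
      (cst t) \* (fun g => re_part (g y)).
    by apply/funext => g; exact: re_dual_scal.
  by rewrite E in c1; exact: cvg_unique c1 (cvgM (cvg_cst t) c2).
exists f; split=> //=; apply: weak_star_cvg => y; rewrite fphi.
by have [] := phiP y.
Qed.

End dual_ball_compactness.

(** * Extreme points of the dual ball *)

Section dual_ball_geometry.
Context {R : realType} {k : scalars} {Y : normedModType (scalar_field R k)}.
Local Notation K := (scalar_field R k).
Local Notation ball := (dual_ball Y).
Implicit Types (f g : dual Y) (U L : set (dual Y)).

Lemma near_re_lt (f : weak_star Y) y (c : R) : re_part (f y) < c ->
  nbhs f [set g : weak_star Y | re_part (g y) < c].
Proof. exact: (cvgr_lt _ (re_eval_continuous (y := y) (x := f))). Qed.

Lemma near_re_gt (f : weak_star Y) y (c : R) : c < re_part (f y) ->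
  nbhs f [set g : weak_star Y | c < re_part (g y)].
Proof. exact: (cvgr_gt _ (re_eval_continuous (y := y) (x := f))). Qed.

Lemma cvg_conv (I : Type) (F : set_system I) (a b : I -> weak_star Y) (t : I -> R)
    (a0 b0 : weak_star Y) (t0 : R) : Filter F ->
  a @ F --> a0 -> b @ F --> b0 -> t @ F --> t0 ->
  (fun i => (scal (t i) *: (a i : dual Y) + scal (1 - t i) *: (b i : dual Y)
              : weak_star Y)) @ F
  --> (scal t0 *: (a0 : dual Y) + scal (1 - t0) *: (b0 : dual Y) : weak_star Y).
Proof.
move=> FF Fa Fb Ft; apply: weak_star_cvg => y; rewrite re_dual_conv.
have ya : (fun i => re_part (a i y) : R) @ F --> (re_part (a0 y) : R).
  exact: (cvg_comp a (fun g : weak_star Y => re_part (g y) : R) Fa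
    (re_eval_continuous (y := y) (x := a0))).
have yb : (fun i => re_part (b i y) : R) @ F --> (re_part (b0 y) : R).
  exact: (cvg_comp b (fun g : weak_star Y => re_part (g y) : R) Fb
    (re_eval_continuous (y := y) (x := b0))).
have E : (fun i => t i * re_part (a i y) + (1 - t i) * re_part (b i y) : R) =
    fun i => re_part ((scal (t i) *: (a i : dual Y) + scal (1 - t i) *: (b i : dual Y)) y).
  by apply/funext => i; rewrite re_dual_conv.
have : (fun i => t i * re_part (a i y) + (1 - t i) * re_part (b i y) : R) @ F
    --> (t0 * re_part (a0 y) + (1 - t0) * re_part (b0 y) : R).
  exact: cvgD (cvgM Ft ya) (cvgM (cvgB (cvg_cst (1 : R)) Ft) yb).
by rewrite E.
Qed.

(** Openness relative to the ball; [U] itself may contain points outside the ball. *)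
Definition rel_open U := forall f : weak_star Y, U f ->
  nbhs f ([set g | ball g -> U g] : set (weak_star Y)).

Definition proper_open_convex U :=
  [/\ U `<=` ball, real_convex U, rel_open U & ~ ball `<=` U].

(** Compactness keeps the union proper: a chain of relatively open sets covering the ball would have
    a single member covering it. *)
Lemma proper_open_convex_bigcup (C : set (set (dual Y))) : C !=set0 ->
  total_on C subset -> C `<=` proper_open_convex ->
  proper_open_convex (\bigcup_(U in C) U).
Proof.
move=> [U0 CU0] totC CP; split.
- by move=> f [U CU]; have [UB _ _ _] := CP _ CU; exact: UB.
- move=> f g t [U CU Uf] [U' CU' Ug] t0 t1.
  have [UU'|U'U] := totC _ _ CU CU'.
    by exists U' => //; have [_ cU' _ _] := CP _ CU'; apply: cU' => //; exact: UU'.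
  by exists U => //; have [_ cU _ _] := CP _ CU; apply: cU => //; exact: U'U.
- move=> f [U CU Uf]; have [_ _ oU _] := CP _ CU.
  by apply: filterS (oU f Uf) => g Ug Bg; exists U => //; exact: Ug.
- move=> BC.
  have /compact_near_coveringP/near_covering_withinP := @dual_ball_compact R k Y.
  (* The filter of tails of the chain turns the near-covering form of compactness into the choice of
     one member. *)
  pose F : set_system (set (dual Y)) :=
    filter_from C (fun U => [set U' | U `<=` U']).
  have FF : Filter F.
    apply: filter_from_filter; first by exists U0.
    move=> U U' CU CU'; have [UU'|U'U] := totC _ _ CU CU'.
      by exists U' => // V U'V; split=> //; exact: subset_trans U'V.
    by exists U => // V U'V; split=> //; exact: subset_trans U'V.
  move=> /(_ _ F (fun U f => U f) FF)[].
    move=> f /BC[U CU Uf]; have [_ _ oU _] := CP _ CU.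
    exists ([set g | ball g -> U g], [set U' | U `<=` U']).
      by split; [exact: oU|exists U].
    by move=> [g U'] /= [Ug UU'] /Ug; exact: UU'.
  by move=> U CU /(_ U) BU; have [_ _ _ nU] := CP _ CU; apply: nU; exact: BU.
Qed.

Lemma maximal_proper_open_convex U : proper_open_convex U -> exists M,
  [/\ U `<=` M, proper_open_convex M &
      forall V, proper_open_convex V -> M `<=` V -> V `<=` M].
Proof.
(* Joining [U] to each set handles the empty chain, whose union then becomes [U] instead of the
   empty set. *)
move=> pU; pose P V := proper_open_convex (V `|` U).
have [C CP totC|V [PV Vmax]] := @Zorn_bigcup (dual Y) P.
  pose D := U |` [set V `|` U | V in C].
  have -> : P (\bigcup_(V in C) V) = proper_open_convex (\bigcup_(V in D) V).
    congr (proper_open_convex _); apply/seteqP; split=> f.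
      case=> [[V CV Vf]|Uf]; last by exists U => //; left.
      by exists (V `|` U); [right; exists V|left].
    by case=> _ [->|[V CV <-]]; [right|case=> ?; [left; exists V|right]].
  apply: proper_open_convex_bigcup.
  - by exists U; left.
  - move=> _ _ [->|[V CV <-]] [->|[V' CV' <-]].
    + by left.
    + by left=> f; right.
    + by right=> f; right.
    + by have [VV'|V'V] := totC _ _ CV CV'; [left|right]; apply: setSU.
  - by move=> _ [->//|[V CV <-]]; exact: CP.
exists (V `|` U); split=> // W pW VW f Wf.
have [//|nVU] := pselect ((V `|` U) f); case: (Vmax W).
  by split; [move=> g Vg; apply: VW; left|move=> WV; apply: nVU; left; exact: WV].
rewrite /P; have -> // : W `|` U = W.
by apply/seteqP; split=> [g [//|Ug]|g]; [apply: VW; right|left].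
Qed.

Lemma dual_conv0 f g : scal 0 *: f + scal (1 - 0) *: g = g.
Proof. by rewrite rmorph0 scale0r add0r subr0 rmorph1 scale1r. Qed.

Lemma dual_conv1 f g : scal 1 *: f + scal (1 - 1) *: g = f.
Proof. by rewrite subrr rmorph0 scale0r addr0 rmorph1 scale1r. Qed.

Lemma dual_convC f g (t : R) :
  scal t *: f + scal (1 - t) *: g = scal (1 - t) *: g + scal (1 - (1 - t)) *: f.
Proof. by apply: dual_re_inj => y; rewrite !re_dual_conv; ring. Qed.

(* If the inclusion fails for [f] and [t], then the preimage of [M] under the
   contraction [g |-> t g + (1 - t) f] is [M] by maximality; iterating the
   contraction, every [g] in the ball has an iterate close to [f], so in [M]. *)
Lemma maximal_proper_open_convex_segment M f g (t : R) : proper_open_convex M ->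
  (forall V, proper_open_convex V -> M `<=` V -> V `<=` M) ->
  M f -> ball g -> 0 <= t -> t < 1 -> M (scal t *: g + scal (1 - t) *: f).
Proof.
move=> pM Mmax Mf Bg t0 t1; have [MB cM oM nM] := pM.
have Bf := MB _ Mf; have cB := @dual_ball_convex R k Y.
pose V := [set h | ball h /\ M (scal t *: h + scal (1 - t) *: f)].
have [BV|nV] := pselect (ball `<=` V); first by have [] := BV _ Bg.
have VM : V `<=` M.
  apply: Mmax; last first.
    by move=> h Mh; split; [exact: MB|apply: cM => //; exact: ltW].
  split=> //; first by move=> h [].
  - move=> h h' s [Bh Mh] [Bh' Mh'] s0 s1; split; first exact: cB.
    have := cM _ _ s Mh Mh' s0 s1; congr M.
    by apply: dual_re_inj => y; rewrite !re_dual_conv; ring.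
  - move=> h [Bh Mh].
    have : (fun h' : weak_star Y =>
        (scal t *: (h' : dual Y) + scal (1 - t) *: f : weak_star Y)) @ h
        --> (scal t *: (h : dual Y) + scal (1 - t) *: f : weak_star Y).
      apply: (@cvg_conv _ (nbhs (h : weak_star Y)) id (cst (f : weak_star Y)) (cst t)).
      - exact: cvg_id.
      - exact: cvg_cst.
      - exact: cvg_cst.
    move=> /(_ _ (oM _ Mh)) N.
    apply: (@filterS _ (nbhs (h : weak_star Y)) _ _ _ _ N) => h' /= Mh' Bh'.
    split=> //.
    by apply: Mh'; apply: cB => //; exact: ltW.
case: nM => h Bh.
have iter n h' : ball h' ->
    M (scal (t ^+ n) *: h' + scal (1 - t ^+ n) *: f) -> M h'.
  elim: n h' => [|n IH] h' Bh'; first by rewrite expr0 dual_conv1.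
  move=> Mh'; apply: (IH) => //; apply: VM; split.
    by apply: cB; rewrite ?exprn_ge0 ?exprn_ile1 // ltW.
  move: Mh'; congr M; apply: dual_re_inj => y; rewrite !re_dual_conv exprS; ring.
have : (fun n => (scal (t ^+ n) *: h + scal (1 - t ^+ n) *: f : weak_star Y)) @ \oo
    --> (scal 0 *: h + scal (1 - 0) *: f : weak_star Y).
  apply: (@cvg_conv _ _ (cst (h : weak_star Y)) (cst (f : weak_star Y))).
  - exact: cvg_cst.
  - exact: cvg_cst.
  - by apply: cvg_expr; rewrite ger0_norm.
rewrite dual_conv0 => /(_ _ (oM _ Mf)) [n _ /(_ n (leqnn n)) Mn].
apply: (iter n) => //; apply: Mn.
by apply: cB; rewrite ?exprn_ge0 ?exprn_ile1 // ltW.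
Qed.

(* The complement in the ball of a maximal proper relatively open convex set is
   a single point (Leger's proof of the Krein-Milman theorem). *)
Lemma proper_open_convex_extreme U : proper_open_convex U ->
  exists2 e, extreme_points ball e & ~ U e.
Proof.
move=> /maximal_proper_open_convex[M [UM pM Mmax]]; have [MB cM oM nM] := pM.
have seg f g t := maximal_proper_open_convex_segment (f := f) (g := g) (t := t) pM Mmax.
have cB := @dual_ball_convex R k Y.
have uniq a b : ball a -> ball b -> ~ M a -> ~ M b -> a = b.
  move=> Ba Bb nMa nMb; apply: dual_re_inj => y.
  wlog : a b Ba Bb nMa nMb / re_part (a y) <= re_part (b y).
    by move=> H; case: (leP (re_part (a y)) (re_part (b y))) => [|/ltW] /H-> //.
  rewrite le_eqVlt => /predU1P[//|ab]; exfalso.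
  (* Adding to [M] the half of the ball below the level [c] captures [a] but not [b], against
     maximality. The enlarged set is convex by [seg]. *)
  pose c := (re_part (a y) + re_part (b y)) / 2.
  have ac : re_part (a y) < c by rewrite /c; lra.
  have cb : c < re_part (b y) by rewrite /c; lra.
  pose V := [set g | ball g /\ (M g \/ re_part (g y) < c)].
  suff /Mmax VM : proper_open_convex V.
    by apply: nMa; apply: VM => [g Mg|]; split=> //; [exact: MB|left|right].
  split.
  - by move=> g [].
  - move=> f g t [Bf Mf] [Bg Mg] t0 t1; split; first exact: cB.
    move: t0 t1; rewrite le_eqVlt => /predU1P[<- _|t0]; first by rewrite dual_conv0.
    rewrite le_eqVlt => /predU1P[->|t1]; first by rewrite dual_conv1.
    case: Mf => Mf; last case: Mg => Mg.
    + by left; rewrite dual_convC; apply: seg => //; lra.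
    + by left; apply: seg => //; exact: ltW.
    + by right; rewrite re_dual_conv; nra.
  - move=> f [Bf [Mf|fc]].
      by apply: filterS (oM _ Mf) => g /= Mg Bg; split=> //; left; exact: Mg.
    by apply: filterS (near_re_lt fc) => g /= gc Bg; split=> //; right.
  - by move=> /(_ _ Bb)[_ [//|]]; rewrite ltNge ltW.
have [e [Be nMe]] : exists e, ball e /\ ~ M e.
  by apply: contrapT => /forallNP H; apply: nM => f Bf;
    apply: contrapT => nMf; apply: (H f).
exists e => //; last by move=> /UM.
split=> // f g t Bf Bg /andP[t0 t1] ee.
have te : t = scal (re_part t) by apply: ge0_scal; exact: ltW.
move: t0 t1 ee; rewrite te -{1}(rmorph0 scal) -{1}(rmorph1 scal) !scal_lt => t0 t1.
rewrite -{1}(rmorph1 scal) -rmorphB /= => ee.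
(* An endpoint in [M] would pull [e] into [M] by [seg]; so both endpoints are missing points, and
   these coincide with [e]. *)
have [Mf|nMf] := pselect (M f).
  by exfalso; apply: nMe; rewrite ee dual_convC; apply: seg => //; lra.
have [Mg|nMg] := pselect (M g).
  by exfalso; apply: nMe; rewrite ee; apply: seg => //; exact: ltW.
by rewrite (uniq f e) // (uniq g e).
Qed.

(** The functionals that do not attain the norm at [y] form a proper relatively open convex set,
    which therefore misses an extreme point. *)
Lemma norming_extreme y : exists2 e, extreme_points ball e & re_part (e y) = nrm y.
Proof.
have [|e [Be ee] ne] := @proper_open_convex_extreme
    [set g | ball g /\ re_part (g y) < nrm y].
  split.
  - by move=> g [].
  - move=> f g t [Bf fy] [Bg gy] t0 t1; split; first exact: dual_ball_convex.
    by rewrite re_dual_conv; have [] := ltP t 1 => ?; nra.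
  - move=> f [Bf fy]; apply: filterS (near_re_lt fy) => g /= gy Bg; split=> //.
  - have [f Bf fy] := norming_functional y.
    by move=> /(_ _ Bf)[_]; rewrite fy ltxx.
exists e => //; apply/eqP; rewrite eq_le; have /dual_ballP -> /= := Be.
by rewrite leNgt; apply/negP => lt; apply: ne.
Qed.

End dual_ball_geometry.

(** * Weak-star separation, Choquet's lemma and the Baire property *)

Section dual_ball_slices.
Context {R : realType} {k : scalars} {Y : normedModType (scalar_field R k)}.
Local Notation K := (scalar_field R k).
Local Notation ball := (dual_ball Y).
Implicit Types (e f g : dual Y) (U L : set (dual Y)).

Let sqdist e (ys : seq Y) f : R := \sum_(y <- ys) (re_part (f y) - re_part (e y)) ^+ 2.

Let sqdist_continuous e ys : continuous (sqdist e ys : weak_star Y -> R).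
Proof.
elim: ys => [|y ys IH] f; have FF := nbhs_filter (f : weak_star Y).
  have -> : sqdist e [::] = cst 0 by apply/funext => g; rewrite /sqdist big_nil.
  exact: (@cvg_cst _ _ _ _ FF).
have -> : sqdist e (y :: ys) =
    fun g => (re_part (g y) - re_part (e y)) * (re_part (g y) - re_part (e y))
             + sqdist e ys g.
  by apply/funext => g; rewrite /sqdist big_cons expr2.
have H : (fun g : weak_star Y => re_part (g y) - re_part (e y) : R) @ (f : weak_star Y)
    --> (re_part (f y) - re_part (e y) : R).
  exact: cvgB (re_eval_continuous (y := y) (x := f)) (cvg_cst _).
exact: cvgD (cvgM H H) (IH f).
Qed.

Let sqdist_gt0 e ys y f : y \in ys -> re_part (f y) != re_part (e y) ->
  0 < sqdist e ys f.
Proof.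
move=> yys fey; rewrite lt_neqAle sumr_ge0 ?andbT => [|i _]; last exact: sqr_ge0.
rewrite eq_sym psumr_eq0 => [|i _]; last exact: sqr_ge0.
apply/negP => /allP/(_ _ yys) /=; rewrite sqrf_eq0 subr_eq0.
by rewrite (negbTE fey).
Qed.

Let sqdist_finite e L : compact (L : set (weak_star Y)) -> ~ L e ->
  exists ys, forall f, L f -> 0 < sqdist e ys f.
Proof.
move=> /compact_near_coveringP cL nLe.
(* Lists of vectors directed by inclusion: each point of [L] is told apart from [e] by one vector,
   and compactness collects finitely many. *)
pose F : set_system (seq Y) :=
  filter_from setT (fun ys : seq Y => [set zs : seq Y | {subset ys <= zs}]).
have FF : Filter F.
  apply: (@filter_from_filter (seq Y) (seq Y)); first by exists [::].
  move=> ys zs _ _; exists (ys ++ zs) => // us sub; split=> y yy; apply: sub.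
    by rewrite mem_cat yy.
  by rewrite mem_cat yy orbT.
case: (cL _ F (fun ys f => 0 < sqdist e ys f) FF) => [f Lf|ys _ /(_ ys)]; last first.
  by move=> H; exists ys => f Lf; exact: H.
have [y fy] : exists y, re_part (f y) != re_part (e y).
  apply: contrapT => /forallNP H; apply: nLe; rewrite -(_ : f = e) //.
  by apply: dual_re_inj => y; apply/eqP/negPn/negP => /H.
exists ([set g : weak_star Y | re_part (g y) != re_part (e y)],
        [set zs : seq Y | {subset [:: y] <= zs}]); last first.
  by move=> [g zs] /= [gy yzs]; apply: sqdist_gt0 gy; apply: yzs; rewrite inE.
split; last by exists [:: y].
move: fy; rewrite neq_lt => /orP[lt|gt].
  by apply: filterS (near_re_lt lt) => g /= lt'; rewrite lt_eqF.
by apply: filterS (near_re_gt gt) => g /= gt'; rewrite gt_eqF.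
Qed.

(* The functional is the direction from [e] to a nearest point of [L] for the
   Euclidean distance given by finitely many evaluations that separate [e] from
   the compact set [L]. *)
Lemma weak_star_separation L e : compact (L : set (weak_star Y)) -> real_convex L ->
  ~ L e -> exists y (c : R), (forall f, L f -> re_part (f y) < c) /\ c < re_part (e y).
Proof.
move=> cL cvL nLe; have [L0|L0] := pselect (L !=set0); last first.
  exists 0, (-1); split=> [f Lf|]; first by case: L0; exists f.
  by rewrite linear0 raddf0 ltrN10.
have [ys ysP] := sqdist_finite cL nLe.
have [f0 /set_mem Lf0 f0min] := @compact_EVT_min (weak_star Y) R (sqdist e ys) L L0 cL
  (continuous_subspaceT (@sqdist_continuous e ys)).
pose d y := re_part (f0 y) - re_part (e y).
have dE : \sum_(y <- ys) d y ^+ 2 = sqdist e ys f0 by [].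
(* The variational inequality at the nearest point [f0], obtained by comparing it with points on the
   segment from [f0] to [f]. *)
have var f : L f -> 0 <= \sum_(y <- ys) d y * (re_part (f y) - re_part (f0 y)).
  move=> Lf; set D := \sum_(y <- ys) _.
  pose H := \sum_(y <- ys) (re_part (f y) - re_part (f0 y)) ^+ 2.
  have H0 : 0 <= H by rewrite sumr_ge0 // => i _; exact: sqr_ge0.
  have ineq (s : R) : 0 < s -> s <= 1 -> 0 <= D *+ 2 + s * H.
    move=> s0 s1; have := f0min _ (mem_set (cvL _ _ s Lf Lf0 (ltW s0) s1)).
    rewrite -dE -subr_ge0 /sqdist -sumrB.
    under eq_bigr => y _.
      rewrite re_dual_conv (_ : _ - _ = s * (d y * (re_part (f y) - re_part (f0 y)) *+ 2
         + s * (re_part (f y) - re_part (f0 y)) ^+ 2)); last by rewrite /d; ring.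
      over.
    by rewrite -mulr_sumr big_split /= -mulr_sumr -sumrMnl pmulr_rge0.
  rewrite leNgt; apply/negP => D0.
  have H1 : 0 < H + 1 by lra.
  (* If [D] were negative, [s = - D / (H + 1)] would make [D *+ 2 + s * H] negative; when this value
     exceeds [1], already [s = 1] does. *)
  have [D1|D1] := leP (- D / (H + 1)) 1.
    have := ineq (- D / (H + 1)); rewrite divr_gt0 ?oppr_gt0 // => /(_ isT D1).
    have : - D / (H + 1) * H <= - D.
      by rewrite mulrAC ler_pdivrMr // ler_wpM2l ?oppr_ge0 ?ltW //; lra.
    by lra.
  have := ineq 1 ltr01 (lexx 1).
  by move: D1; rewrite ltr_pdivlMr //; lra.
pose y0 := - \sum_(y <- ys) scal (d y) *: y.
have ey0 f : re_part (f y0) = - \sum_(y <- ys) d y * re_part (f y).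
  rewrite /y0 linearN raddfN linear_sum raddf_sum /=; congr (- _).
  by apply: eq_bigr => y _; rewrite re_dual_scal.
have e0 := ysP _ Lf0.
exists y0, (re_part (e y0) - sqdist e ys f0 / 2); split; last by lra.
move=> f Lf; have := var _ Lf; rewrite !ey0.
have -> : \sum_(y <- ys) d y * (re_part (f y) - re_part (f0 y)) =
   \sum_(y <- ys) d y * re_part (f y) - \sum_(y <- ys) d y * re_part (e y)
   - sqdist e ys f0.
  rewrite -dE -!sumrB; apply: eq_bigr => y _; rewrite /d; ring.
by lra.
Qed.

(** Merges two weighted points into one of total weight [a + b]; this regrouping makes the join of
    two convex sets convex. *)
Let convex_comb L f g (a b : R) : real_convex L -> L f -> L g -> 0 <= a -> 0 <= b ->
  exists2 h, L h & forall y,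
    a * re_part (f y) + b * re_part (g y) = (a + b) * re_part (h y).
Proof.
move=> cL Lf Lg a0 b0; have [ab|ab] := eqVneq (a + b) 0.
  have a0' : a = 0 by lra.
  have b0' : b = 0 by lra.
  by exists f => // y; rewrite a0' b0'; ring.
have ab0 : 0 < a + b by rewrite lt_neqAle eq_sym ab addr_ge0.
exists (scal (a / (a + b)) *: f + scal (1 - a / (a + b)) *: g).
  apply: cL => //; first by rewrite divr_ge0 // addr_ge0.
  by rewrite ler_pdivrMr // mul1r lerDl.
by move=> y; rewrite re_dual_conv; field.
Qed.

(** The join is the union of all segments from [L1] to [L2], a continuous image of a compact
    product. An extreme point on such a segment is an endpoint, so [e] stays outside. *)
Let compact_join L1 L2 e : extreme_points ball e ->
  compact (L1 : set (weak_star Y)) -> real_convex L1 -> L1 `<=` ball -> ~ L1 e ->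
  compact (L2 : set (weak_star Y)) -> real_convex L2 -> L2 `<=` ball -> ~ L2 e ->
  exists L, [/\ compact (L : set (weak_star Y)), real_convex L, L `<=` ball, ~ L e &
    L1 `|` L2 `<=` L].
Proof.
move=> [Be ext] c1 cv1 B1 n1 c2 cv2 B2 n2.
have [[f1 Lf1]|L10] := pselect (L1 !=set0); last first.
  by exists L2; split=> // f [Lf|//]; case: L10; exists f.
have [[f2 Lf2]|L20] := pselect (L2 !=set0); last first.
  by exists L1; split=> // f [//|Lf]; case: L20; exists f.
pose j (p : R * (weak_star Y * weak_star Y)) : weak_star Y :=
  scal p.1 *: (p.2.1 : dual Y) + scal (1 - p.1) *: (p.2.2 : dual Y).
exists (j @` (`[0, 1] `*` (L1 `*` L2))); split.
- apply: (@continuous_compact (R * (weak_star Y * weak_star Y))%type 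
    (weak_star Y) j); last first.
    by apply: compact_setX; [exact: segment_compact|exact: compact_setX].
  apply: continuous_subspaceT => p.
  apply: (@cvg_conv R k Y _ (nbhs p) (fun p => p.2.1) (fun p => p.2.2) (fun p => p.1)).
  + by apply: (cvg_comp snd fst); [exact: cvg_snd|exact: cvg_fst].
  + by apply: (cvg_comp snd snd); [exact: cvg_snd|exact: cvg_snd].
  + exact: cvg_fst.
- move=> _ _ s [[t [f g]] [/= t01 [Lf Lg]] <-] [[u [f' g']] [/= u01 [Lf' Lg']] <-] s0 s1.
  move: t01 u01; rewrite /= !in_itv /= => /andP[t0 t1] /andP[u0 u1].
  have s1' : 0 <= 1 - s by lra.
  have t1' : 0 <= 1 - t by lra.
  have u1' : 0 <= 1 - u by lra.
  have [h Lh hE] := convex_comb cv1 Lf Lf' (mulr_ge0 s0 t0) (mulr_ge0 s1' u0).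
  have [h' Lh' hE'] := convex_comb cv2 Lg Lg' (mulr_ge0 s0 t1') (mulr_ge0 s1' u1').
  exists (s * t + (1 - s) * u, (h, h')).
    split=> //=; rewrite in_itv /=; apply/andP; split.
      by rewrite addr_ge0 // mulr_ge0.
    by have := mulr_ge0 s0 t1'; have := mulr_ge0 s1' u1'; lra.
  apply: dual_re_inj => y.
  have -> : re_part ((scal s *: (j (t, (f, g)) : dual Y) +
      scal (1 - s) *: (j (u, (f', g')) : dual Y)) y) =
    s * (t * re_part (f y) + (1 - t) * re_part (g y)) +
    (1 - s) * (u * re_part (f' y) + (1 - u) * re_part (g' y)).
    by rewrite re_dual_conv /j /= !re_dual_conv.
  rewrite /j /= re_dual_conv -hE.
  have -> : 1 - (s * t + (1 - s) * u) = s * (1 - t) + (1 - s) * (1 - u) by ring.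
  by rewrite -hE'; ring.
- move=> _ [[t [f g]] [/= t01 [Lf Lg]] <-].
  move: t01; rewrite /= in_itv /= => /andP[t0 t1].
  by apply: dual_ball_convex => //; [exact: B1|exact: B2].
- move=> [[t [f g]] [/= t01 [Lf Lg]]].
  move: t01; rewrite /= in_itv /= /j /= => /andP[t0 t1] fge.
  move: t0; rewrite le_eqVlt => /predU1P[t0|t0].
    by apply: n2; rewrite -fge -t0 dual_conv0.
  move: t1; rewrite le_eqVlt => /predU1P[t1|t1].
    by apply: n1; rewrite -fge t1 dual_conv1.
  have [] := ext f g (scal t) (B1 _ Lf) (B2 _ Lg).
  - by rewrite -{1}(rmorph0 scal) -(rmorph1 scal) !scal_lt t0.
  - by rewrite -[in RHS](rmorph1 scal) -rmorphB -fge.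
  - by move=> fe _; apply: n1; rewrite -fe.
- move=> f [Lf|Lf].
    by exists (1, (f, f2)); [rewrite /= in_itv /= lexx ler01|rewrite /j /= dual_conv1].
  by exists (0, (f1, f)); [rewrite /= in_itv /= lexx ler01|rewrite /j /= dual_conv0].
Qed.

Let halfspace_compact (P : set R) y : closed P ->
  compact ([set f | ball f /\ P (re_part (f y))] : set (weak_star Y)).
Proof.
move=> cP; apply: compact_closedI; first exact: dual_ball_compact.
apply: (preimage_closed (f := fun f : weak_star Y => re_part (f y) : R)) => // f _.
exact: re_eval_continuous.
Qed.

(* Choquet's lemma: in the dual ball, the open slices that contain an extreme
   point [e] form a weak-star neighbourhood base of [e]. *)
Lemma extreme_slice e (U : set (weak_star Y)) : extreme_points ball e ->
  nbhs (e : weak_star Y) U -> exists y (c : R), c < re_part (e y) /\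
    forall f, ball f -> c < re_part (f y) -> U f.
Proof.
move=> xe.
pose good L := [/\ compact (L : set (weak_star Y)), real_convex L, L `<=` ball & ~ L e].
(* The sets whose complement in the ball is covered by a good set form a filter by [compact_join].
   It converges to [e], because the ball outside a strip around [re_part (e y)] consists of two good
   sets; separating [e] from the good set for [U] then gives the slice. *)
pose F : set_system (weak_star Y) :=
  [set V | exists2 L, good L & forall f, ball f -> ~ V f -> L f].
have joinF L1 L2 : good L1 -> good L2 -> exists2 L, good L & L1 `|` L2 `<=` L.
  move=> [c1 cv1 B1 n1] [c2 cv2 B2 n2].
  by have [L [? ? ? ? ?]] := compact_join xe c1 cv1 B1 n1 c2 cv2 B2 n2; exists L.
have FF : Filter F.
  split=> [|P Q [L1 g1 P1] [L2 g2 P2]|P Q PQ [L gL PL]].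
  - exists set0; last by move=> f _ /(_ I).
    by rewrite /good; split=> //; exact: compact0.
  - have [L gL L12] := joinF _ _ g1 g2; exists L => // f Bf nPQ.
    have : (~` (P `&` Q)) f by [].
    by rewrite setCI => -[/(P1 _ Bf)|/(P2 _ Bf)] Lf; apply: L12; [left|right].
  - by exists L => // f Bf nQ; apply: PL => // /PQ.
have Fe : F --> (e : weak_star Y).
  apply: weak_star_cvg => y; apply/cvgrPdist_lt => d d0.
  have half (P : set R) : closed P -> ~ P (re_part (e y)) ->
      (forall a b t, P a -> P b -> 0 <= t -> t <= 1 -> P (t * a + (1 - t) * b)) ->
      good [set f | ball f /\ P (re_part (f y))].
    move=> cP nP cvP; rewrite /good; split;
      [exact: halfspace_compact| |by move=> f []|by move=> []].
    move=> f g t [Bf Pf] [Bg Pg] t0 t1; split; first exact: dual_ball_convex.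
    by rewrite re_dual_conv; exact: cvP.
  have [||L gL L12] := joinF
      [set f | ball f /\ [set r | r <= re_part (e y) - d] (re_part (f y))]
      [set f | ball f /\ [set r | re_part (e y) + d <= r] (re_part (f y))].
  - apply: half => [||a b t /= ? ? ? ?]; [exact: closed_le|rewrite /=; lra|nra].
  - apply: half => [||a b t /= ? ? ? ?]; [exact: closed_ge|rewrite /=; lra|nra].
  exists L => // f Bf /negP; rewrite -leNgt ler_normr => /orP fd.
  by apply: L12; case: fd => ?; [left|right]; split=> //=; lra.
move=> /Fe[L [cL cvL BL nLe] UL].
have [y [c [Lc ce]]] := weak_star_separation cL cvL nLe.
exists y, c; split=> // f Bf cf; apply: contrapT => /(UL _ Bf) /Lc.
by rewrite ltNge ltW.
Qed.

(* The slices are nested, so the complement of their intersection is an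
   increasing union of convex sets, hence convex: it misses an extreme point. *)
Lemma extreme_baire (O : nat -> set (dual Y)) :
  (forall n, rel_open (O n)) ->
  (forall n y (c : R), c < nrm y -> exists e,
    [/\ extreme_points ball e, c < re_part (e y) & O n e]) ->
  forall y (c : R), c < nrm y -> exists e,
    [/\ extreme_points ball e, c < re_part (e y) & forall n, O n e].
Proof.
move=> oO dO y0 c0 c0y0.
(* The new level lies strictly between [c'] and the value at [e], so the closed slice at that level
   is inside the previous open slice and inside [O n]. *)
have step (q : nat * (Y * R)) : exists p : Y * R, q.2.2 < nrm q.2.1 ->
    p.2 < nrm p.1 /\ forall f, ball f -> p.2 <= re_part (f p.1) ->
      q.2.2 < re_part (f q.2.1) /\ O q.1 f.
  case: q => n [y c] /=; have [cy|_] := ltP c (nrm y); last by exists (0, 0).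
  have [e [xe ce Oe]] := dO n y c cy.
  have [|y' [c' [ce' sub]]] := @extreme_slice e
      [set g | (ball g -> O n g) /\ c < re_part (g y)] xe.
    by apply: filterI; [exact: oO|exact: near_re_gt].
  exists (y', (c' + re_part (e y')) / 2) => _ /=; split.
    by have /dual_ballP/(_ y') := xe.1; lra.
  move=> f Bf ?; have [|Of cf] := sub f Bf; first by lra.
  by split=> //; exact: Of.
have [next nextP] := choice step.
(* Starting halfway between [c0] and the norm makes the final inequality at [y0] strict. *)
pose s := fix s n := if n is n'.+1 then next (n', s n') else (y0, (c0 + nrm y0) / 2).
have sP n : (s n).2 < nrm (s n).1.
  by elim: n => [/=|n IH]; [lra|have [] := nextP (n, s n) IH].
have sS n f : ball f -> (s n.+1).2 <= re_part (f (s n.+1).1) ->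
    (s n).2 < re_part (f (s n).1) /\ O n f.
  by have [_] := nextP (n, s n) (sP n); apply.
have smono n m f : ball f -> (n <= m)%N -> re_part (f (s n).1) < (s n).2 ->
    re_part (f (s m).1) < (s m).2.
  move=> Bf /subnK <-; elim: (m - n)%N => [//|i IH] /IH lt.
  rewrite addSn ltNge; apply/negP => /(sS _ _ Bf)[].
  by rewrite ltNge ltW.
have [|e xe ne] := @proper_open_convex_extreme R k Y
    [set f | ball f /\ exists n, re_part (f (s n).1) < (s n).2].
  split.
  - by move=> f [].
  - move=> f g t [Bf [n fn]] [Bg [m gm]] t0 t1; split; first exact: dual_ball_convex.
    exists (maxn n m); rewrite re_dual_conv.
    have := smono _ _ _ Bf (leq_maxl n m) fn.
    have := smono _ _ _ Bg (leq_maxr n m) gm.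
    by have [] := ltP t 1 => ?; nra.
  - move=> f [Bf [n fn]]; apply: filterS (near_re_lt fn) => g /= gn Bg.
    by split=> //; exists n.
  (* If the complements covered the ball, compactness would give one [n] whose slice is empty,
     against a norming functional. *)
  - move=> BU.
    have /compact_near_coveringP/near_covering_withinP := @dual_ball_compact R k Y.
    move=> /(_ _ \oo (fun n f => re_part (f (s n).1) < (s n).2) _)[].
      move=> f /BU[Bf [n fn]].
      exists ([set g : weak_star Y | re_part (g (s n).1) < (s n).2],
              [set m | (n <= m)%N]).
        by split; [exact: near_re_lt|exists n].
      by move=> [g m] /= [gn nm] Bg; exact: smono gn.
    move=> n _ /(_ n (leqnn n)) sn.
    have [f Bf fs] := norming_functional (s n).1.
    by have := sn _ Bf; rewrite fs ltNge (ltW (sP n)).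
have [Be _] := xe.
have se n : (s n).2 <= re_part (e (s n).1).
  by rewrite leNgt; apply/negP => lt; apply: ne; split=> //; exists n.
exists e; split=> // [|n]; last by have [] := sS n e Be (se n.+1).
by have := se 0%N => /=; lra.
Qed.

End dual_ball_slices.

(** * Lushness and slices *)

Section lush_theory.
Context {R : realType} {k : scalars} {X Y : normedModType (scalar_field R k)}.
Context (G : bounded_op X Y).
Local Notation K := (scalar_field R k).

Lemma nrm_conv (Z : normedModType K) (x y : Z) (t : R) : 0 <= t -> t <= 1 ->
  nrm (scal t *: x + scal (1 - t) *: y) <= t * nrm x + (1 - t) * nrm y.
Proof.
move=> t0 t1; rewrite (le_trans (nrmD _ _)) // !nrm_scal.
by rewrite !ger0_norm // subr_ge0.
Qed.

Lemma real_convex_near (Z : normedModType K) (C : set Z) (e : R) : real_convex C ->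
  real_convex [set z | exists2 a, C a & nrm (z - a) < e].
Proof.
move=> cC x y t [a Ca xa] [b Cb yb] t0 t1.
exists (scal t *: a + scal (1 - t) *: b); first exact: cC.
rewrite opprD addrACA -!scalerBr (le_lt_trans (nrm_conv _ _ t0 t1)) //.
by have [] := ltP t 1 => ?; nra.
Qed.

Definition lush_at (x0 : X) (y : Y) (e : R) := exists F : set X,
  [/\ F `<=` unit_ball X, conv_hull F `<=` near_max G y e &
      (set_dist x0 (aconv F) < e%:E)%E].

Definition slice_near (x0 : X) (e : R) (f : dual Y) :=
  (set_dist x0 (aconv (op_slice G f e)) < e%:E)%E.

Lemma op_slice_mono (f : dual Y) (d e : R) : d <= e -> op_slice G f d `<=` op_slice G f e.
Proof. by move=> de x [x1 fx]; split=> //; lra. Qed.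

Lemma slice_near_mono x0 (d e : R) f : d <= e -> slice_near x0 d f -> slice_near x0 e f.
Proof.
move=> de /set_dist_lt[a Sa xa]; apply/set_dist_lt; exists a; last by lra.
by apply: aconv_mono Sa; exact: op_slice_mono.
Qed.

(** On the convex hull of the slice, [f] is still above [1 - d] at [G x]; adding its value at [y]
    gives a norm above [2 - 2 * d]. *)
Lemma slice_near_lush_at x0 y (d e : R) f : d + d <= e -> dual_ball Y f ->
  1 - d < re_part (f y) -> slice_near x0 d f -> lush_at x0 y e.
Proof.
move=> de /dual_ballP Bf fy /set_dist_lt[a Sa xa]; exists (op_slice G f d); split.
- by move=> x [/unit_sphereE x1 _]; apply/unit_ballE; rewrite x1.
- have : conv_hull (op_slice G f d) `<=` [set x | nrm x <= 1 /\ 1 - d < re_part (f (G x))].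
    apply: conv_hull_min => [x z t [x1 fx] [z1 fz] t0 t1|x [/unit_sphereE x1 fx]]; last first.
      by split=> //; rewrite x1.
    split; first by rewrite (le_trans (nrm_conv _ _ t0 t1)) //; nra.
    by rewrite linearD !linearZ re_dualD !re_dual_scal; have [] := ltP t 1 => ?; nra.
  move=> sub x /sub[x1 fx]; split; first exact/unit_ballE.
  by have := Bf (G x + y); rewrite re_dualD; lra.
- apply/set_dist_lt; exists a => //; have := nrm_ge0 (x0 - a); lra.
Qed.

(** Scaling [x] to the sphere moves it by [1 - nrm x], and the norm of [x] is at least the value of
    [f] at [G x], which is nonnegative and can only grow. *)
Lemma normalize_slice (f : dual Y) (x : X) (d : R) : opnorm G <= 1 -> dual_ball Y f ->
  nrm x <= 1 -> d <= 1 -> 1 - d < re_part (f (G x)) ->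
  exists2 s, op_slice G f d s & nrm (x - s) <= 1 - re_part (f (G x)).
Proof.
move=> G1 /dual_ballP Bf x1 d1 fx.
have fGx : re_part (f (G x)) <= nrm x.
  by rewrite (le_trans (Bf _)) // opnorm_contraction.
have x0 : 0 < nrm x by lra.
exists (scal (nrm x)^-1 *: x).
  split; first by apply/unit_sphereE; exact: nrm_normalize.
  rewrite linearZ re_dual_scal (lt_le_trans fx) // ler_peMl //; first by lra.
  by rewrite invf_ge1.
have -> : x - scal (nrm x)^-1 *: x = scal (1 - (nrm x)^-1) *: x.
  by rewrite rmorphB rmorph1 scalerBl scale1r.
have i1 : 1 <= (nrm x)^-1 by rewrite invf_ge1.
rewrite nrm_scal ler0_norm; last by lra.
by rewrite mulNr mulrBl mul1r mulVf ?gt_eqF //; lra.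
Qed.

(* Markov's inequality in convex form: if [f (G u)] is close to [1] for a convex
   combination [u] of points of [F], then the points outside the slice have small
   total weight, and they may be replaced by any point [s0] of the slice. *)
Lemma aconv_slice_approx (F : set X) (d : R) z : opnorm G <= 1 ->
  F `<=` unit_ball X -> 0 < d -> d <= 1 -> aconv F z ->
  exists2 u, conv_hull F u & forall f s0, dual_ball Y f -> op_slice G f d s0 ->
    exists2 z', aconv (op_slice G f d) z' &
      nrm (z - z') <= 2 / d * (1 - re_part (f (G u))).
Proof.
move=> G1 FB d0 d1; move: z; apply: aconv_min.
  move=> z1 z2 t [u1 Fu1 H1] [u2 Fu2 H2] t0 t1.
  exists (scal t *: u1 + scal (1 - t) *: u2); first exact: conv_hull_convex.
  move=> f s0 Bf Ss0; have [z1' S1 n1] := H1 f s0 Bf Ss0.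
  have [z2' S2 n2] := H2 f s0 Bf Ss0.
  exists (scal t *: z1' + scal (1 - t) *: z2'); first exact: aconv_convex.
  rewrite opprD addrACA -!scalerBr (le_trans (nrm_conv _ _ t0 t1)) //.
  rewrite linearD !linearZ re_dualD !re_dual_scal.
  have -> : 1 - (t * re_part (f (G u1)) + (1 - t) * re_part (f (G u2))) =
    t * (1 - re_part (f (G u1))) + (1 - t) * (1 - re_part (f (G u2))) by ring.
  rewrite mulrDr !(mulrCA (2 / d)) lerD // ler_wpM2l //; lra.
move=> w x w1 Fx; exists x; first exact: sub_conv_hull.
have /unit_ballE x1 := FB _ Fx.
move=> f s0 Bf Ss0; have fGx : re_part (f (G x)) <= 1.
  move/dual_ballP : (Bf) => /(_ (G x))/le_trans; apply.
  by rewrite (le_trans (opnorm_contraction _ G1)).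
have d2 : 1 <= 2 / d by rewrite ler_pdivlMr //; lra.
have [fx|fx] := ltP (1 - d) (re_part (f (G x))).
  have [s Ss xs] := normalize_slice G1 Bf x1 d1 fx.
  exists (w *: s); first exact: aconv_mem.
  rewrite -scalerBr nrm_unim // (le_trans xs) // ler_peMl //; lra.
(* Outside the slice the error is at most [2], while [1 - re_part (f (G x))] is at least [d]. *)
exists (w *: s0); first exact: aconv_mem.
rewrite -scalerBr nrm_unim // (le_trans (nrmD _ _)) // nrmN.
have [/unit_sphereE -> _] := Ss0.
apply: (@le_trans _ _ 2); first by lra.
by rewrite mulrAC ler_pdivlMr //; lra.
Qed.

Lemma lush_at_slice (A : set (dual Y)) x0 y (e : R) : opnorm G <= 1 ->
  A `<=` dual_ball Y ->
  (forall y (c : R), c < nrm y -> exists2 f, A f & c < re_part (f y)) ->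
  nrm y <= 1 -> 0 < e -> (forall d : R, 0 < d -> lush_at x0 y d) ->
  exists f, [/\ A f, 1 - e < re_part (f y) & slice_near x0 e f].
Proof.
move=> G1 AB nA y1 e0 L.
(* Lushness is used with precision [h ^+ 2] and the slice with width [h], so the approximation error
   is at most [2 / h * h ^+ 2], and the total distance is below [4 * h]. *)
have [h [h0 h4 he]] : exists h : R, [/\ 0 < h, h <= 1 / 4 & h <= e / 4].
  exists (Num.min (1 / 4) (e / 4)); split.
  - by rewrite lt_min; apply/andP; split; lra.
  - by rewrite ge_min lexx.
  - by rewrite ge_min lexx orbT.
have hh : h ^+ 2 <= h / 4 by rewrite expr2 ler_wpM2l //; lra.
have h2 : 0 < h ^+ 2 by rewrite exprn_gt0.
have h1 : h <= 1 by lra.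
have [F [FB Fn /set_dist_lt[z Fz xz]]] := L _ h2.
have [u Fu uP] := aconv_slice_approx G1 FB h0 h1 Fz.
have [u1 uy] := Fn _ Fu.
have [f Af fuy] := nA _ _ uy; have Bf := AB _ Af.
have [fy fGu] : 1 - h ^+ 2 < re_part (f y) /\ 1 - h ^+ 2 < re_part (f (G u)).
  move: fuy; rewrite re_dualD; move/dual_ballP : (Bf) => Bf'.
  have := Bf' y; have := Bf' (G u); have := opnorm_contraction u G1.
  by move/unit_ballE : u1; split; lra.
(* With an empty slice, all of [conv_hull F] would satisfy [re_part (f (G x)) <= 1 - h], and [u]
   does not. *)
have [s0 Ss0] : exists s0, op_slice G f h s0.
  apply: contrapT => /forallNP nS.
  have : conv_hull F `<=` [set x | re_part (f (G x)) <= 1 - h].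
    apply: conv_hull_min => [x x' t /= fx fx' t0 t1|x Fx /=].
      by rewrite linearD !linearZ re_dualD !re_dual_scal; nra.
    rewrite leNgt; apply/negP => fx.
    have [s Ss _] := normalize_slice G1 Bf (proj1 (unit_ballE _) (FB _ Fx)) h1 fx.
    exact: nS Ss.
  by move=> /(_ _ Fu) /=; lra.
have [z' Sz' zz'] := uP f s0 Bf Ss0.
exists f; split=> //; first by lra.
apply: (@slice_near_mono _ (4 * h)); first by lra.
apply/set_dist_lt; exists z'.
  by apply: aconv_mono Sz'; apply: op_slice_mono; lra.
have : 2 / h * (1 - re_part (f (G u))) <= 2 * h.
  rewrite mulrAC ler_pdivrMr // -mulrA -expr2; lra.
by have := nrm_dist z x0 z'; lra.
Qed.

(** A point of the hull involves finitely many points of the slice, and each of them stays in the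
    slice when [f] moves slightly. *)
Lemma slice_near_rel_open x0 (e : R) : rel_open (slice_near x0 e).
Proof.
move=> f /set_dist_lt[a /aconv_finite[s [sS sa]] xa].
have : nbhs (f : weak_star Y)
    [set g : weak_star Y | forall x, x \in s -> op_slice G g e x].
  elim: s sS {sa} => [|x s IH] sS.
    by apply: (@nearW _ (nbhs (f : weak_star Y))) => g.
  have [x1 fx] := sS x (mem_head _ _).
  have N : nbhs (f : weak_star Y)
      [set g : weak_star Y | forall x, x \in s -> op_slice G g e x].
    by apply: IH => z zs; apply: sS; rewrite inE zs orbT.
  apply: filterS2 (near_re_gt fx) N => g /= gx gs z.
  by rewrite inE => /predU1P[->|/gs//].
apply: filterS => g /= gs _; apply/set_dist_lt; exists a => //.
by apply: aconv_mono sa => x /= /gs.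
Qed.

(** Slices shrink with their width, so countably many widths suffice; this is the source of the
    countable intersection in (iv). *)
Lemma closure_slice_near x0 (f : dual Y) :
  (forall e : R, 0 < e -> closure (aconv (op_slice G f e)) x0) <->
  (forall n : nat, slice_near x0 n.+1%:R^-1 f).
Proof.
split=> [cl n|sn e e0].
  have n0 : 0 < n.+1%:R^-1 :> R by rewrite invr_gt0.
  by apply/set_dist_lt; move/closure_nrm : (cl _ n0); apply.
apply/closure_nrm => d d0.
have m0 : 0 < Num.min d e by rewrite lt_min d0.
have [n nde] : exists n : nat, n.+1%:R^-1 < Num.min d e.
  exists (Num.truncn (Num.min d e)^-1); rewrite invf_plt ?posrE //.
  by rewrite truncnS_gt.
move: nde; rewrite lt_min => /andP[nd ne].
have /set_dist_lt[a Sa xa] := sn n.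
by exists a; [apply: aconv_mono Sa; apply: op_slice_mono; exact: ltW|exact: lt_trans nd].
Qed.

Definition lush_point (x0 : X) :=
  forall y (e : R), unit_sphere Y y -> 0 < e -> lush_at x0 y e.

Lemma closure_slice_lush_point x0 :
  (forall y (e : R), unit_sphere Y y -> 0 < e -> exists f : dual Y,
    [/\ dual_ball Y f, 1 - e < re_part (f y) & closure (aconv (op_slice G f e)) x0]) ->
  lush_point x0.
Proof.
move=> H y e y1 e0; have e2 : 0 < e / 2 by lra.
have [f [Bf fy /closure_nrm cl]] := H y (e / 2) y1 e2.
apply: slice_near_lush_at Bf fy _; first by lra.
exact/set_dist_lt/cl.
Qed.

Context (G_norm : opnorm G = 1).

Let opnormG : opnorm G <= 1. Proof. by rewrite G_norm. Qed.

Lemma sphere_slice y (c : R) : c < nrm y -> exists y' (d : R),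
  [/\ unit_sphere Y y', 0 < d &
      forall f : dual Y, 1 - d < re_part (f y') -> c < re_part (f y)].
Proof.
(* For [y = 0] the level [c] is negative and every functional qualifies; a unit vector still has to
   be produced, and the norm of [G] supplies one. *)
move=> cy; have [y0|y0] := eqVneq y 0.
  have [x x1 Gx] : exists2 x, nrm x <= 1 & 0 < nrm (G x).
    by apply: opnorm_gt; rewrite G_norm.
  exists (scal (nrm (G x))^-1 *: G x), 1; split=> // [|f _].
    by apply/unit_sphereE; exact: nrm_normalize.
  by move: cy; rewrite y0 nrm0 linear0 raddf0.
have yp := nrm_gt0 y0.
exists (scal (nrm y)^-1 *: y), (1 - c / nrm y); split=> [||f].
- by apply/unit_sphereE; exact: nrm_normalize.
- by rewrite subr_gt0 ltr_pdivrMr // mul1r.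
- by rewrite opprB addrCA subrr addr0 re_dual_scal [ltRHS]mulrC ltr_pM2r ?invr_gt0.
Qed.

(** Each condition is relatively open, and [lush_at_slice] for the extreme points shows that it
    meets every slice; [extreme_baire] satisfies all of them at once. *)
Lemma lush_point_slices (xs : nat -> X) (es : nat -> R) :
  (forall n, lush_point (xs n)) -> (forall n, 0 < es n) ->
  forall y (c : R), c < nrm y -> exists f,
    [/\ extreme_points (dual_ball Y) f, c < re_part (f y) &
        forall n, slice_near (xs n) (es n) f].
Proof.
move=> xsP es0; apply: (@extreme_baire R k Y (fun n => slice_near (xs n) (es n))).
  by move=> n; exact: slice_near_rel_open.
move=> n y c cy; have [y' [d [y1 d0 dc]]] := sphere_slice cy.
have m0 : 0 < Num.min d (es n) by rewrite lt_min d0 es0.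
have [|||f [xf fy sf]] := @lush_at_slice (extreme_points (dual_ball Y)) (xs n) y' _
    opnormG _ _ _ m0 (fun r r0 => xsP n y' r y1 r0).
- by move=> f [].
- by move=> z b bz; have [f xf fz] := norming_extreme z; exists f => //; rewrite fz.
- by move/unit_sphereE : y1 => ->.
exists f; split=> //; last by apply: slice_near_mono sf; rewrite ge_min lexx orbT.
by apply: dc; apply: le_lt_trans fy; rewrite lerB // ge_min lexx.
Qed.

Lemma lush_point_dense_Gdelta x0 : lush_point x0 ->
  let E : set (set_type (extreme_points (dual_ball Y) : set (weak_star Y))) :=
    [set f | forall e : R, 0 < e -> closure (aconv (op_slice G (set_val f) e)) x0] in
  dense E /\ Gdelta E.
Proof.
move=> px E; split.
  move=> O [v Ov] [V oV VO].
  have xv : extreme_points (dual_ball Y) (set_val v) by apply: set_mem; exact: valP.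
  have Vv : nbhs (set_val v : weak_star Y) V.
    by apply: open_nbhs_nbhs; split=> //; move: Ov; rewrite -VO.
  have [y [c [cv sub]]] := extreme_slice xv Vv.
  have cy : c < nrm y by rewrite (lt_le_trans cv) //; move/dual_ballP : xv.1; apply.
  have [|f [xf cf fn]] := 
    @lush_point_slices (fun=> x0) (fun n => n.+1%:R^-1) (fun=> px) _ y c cy.
    by move=> n; rewrite invr_gt0.
  exists (exist _ f (mem_set xf)); split.
    by rewrite -VO /=; apply: sub => //; exact: xf.1.
  by apply/closure_slice_near.
pose V n : set (weak_star Y) :=
  interior [set g : weak_star Y | dual_ball Y g -> slice_near x0 n.+1%:R^-1 g].
exists (fun n => set_val @^-1` V n).
  by move=> n; exists (V n) => //; exact: open_interior.
apply/seteqP; split=> [v /closure_slice_near sv n _|v Vv].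
  by apply: slice_near_rel_open; exact: sv.
apply/closure_slice_near => n; have := interior_subset (Vv n I); apply.
have xv : extreme_points (dual_ball Y) (set_val v) by apply: set_mem; exact: valP.
exact: xv.1.
Qed.

Lemma lush_points (B : set X) : closure (aconv B) = unit_ball X ->
  B `<=` lush_point -> lush G.
Proof.
move=> hB Bl; split=> // x0 e y x0B e0 y1.
have /closure_nrm cl : closure (aconv B) x0 by rewrite hB.
have e4 : 0 < e / 4 by lra.
have [z /aconv_finite[s [sB sz]] xz] := cl _ e4.
(* The hull of no points is empty, so the list has a head, which also serves as the default of
   [nth]. *)
case: s sB sz => [|b s] sB sz.
  have : aconv [set` ([::] : seq X)] `<=` set0.
    by apply: aconv_min => [? ? ? []|].
  by move=> /(_ _ sz).
have cy : 1 - e / 4 < nrm y by move/unit_sphereE : y1 => ->; lra.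
have [||f [xf fy fs]] := @lush_point_slices (nth b (b :: s)) (fun=> e / 4) _ _ y _ cy.
- move=> n; apply: Bl; apply: sB.
  have [ns|ns] := ltnP n (size (b :: s)); first exact: mem_nth.
  by rewrite nth_default // mem_head.
- by [].
apply: (@slice_near_lush_at x0 y (e / 2) e f); [lra|exact: xf.1|lra|].
have [a Sa za] : exists2 a, aconv (op_slice G f (e / 4)) a & nrm (z - a) < e / 4.
  move: z sz {xz}; apply: aconv_min; first by apply: real_convex_near; exact: aconv_convex.
  move=> w x w1 xs; have := fs (index x (b :: s)); rewrite nth_index //.
  move=> /set_dist_lt[a Sa xa]; exists (w *: a); first exact: aconv_balanced.
  by rewrite -scalerBr nrm_unim.
apply/set_dist_lt; exists a; last by have := nrm_dist z x0 a; lra.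
by apply: aconv_mono Sa; apply: op_slice_mono; lra.
Qed.

End lush_theory.

(** If [A] were inside the half-space below [c], so would be its convex hull, yet a norming
    functional is a weak-star limit of that hull. *)
Lemma norming_of_hull (R : realType) (k : scalars) (Y : normedModType (scalar_field R k))
    (A : set (dual Y)) : closure (conv_hull A : set (weak_star Y)) = dual_ball Y ->
  forall y (c : R), c < nrm y -> exists2 f, A f & c < re_part (f y).
Proof.
move=> hA y c cy; have [f Bf fy] := norming_functional y.
have cf : c < re_part (f y) by rewrite fy.
have : closure (conv_hull A : set (weak_star Y)) f by rewrite hA.
move=> /(_ _ (near_re_gt (f := f : weak_star Y) cf))[g [Ag /= cg]].
apply: contrapT => nA.
have : conv_hull A `<=` [set f | re_part (f y) <= c].
  apply: conv_hull_min => [f1 f2 t /= c1 c2 t0 t1|h Ah /=].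
    by rewrite re_dual_conv; nra.
  by rewrite leNgt; apply/negP => ch; apply: nA; exists h.
by move=> /(_ _ Ag) /=; rewrite leNgt cg.
Qed.

(** * Separable subspaces *)

Lemma countable_closure (T : Type) (I : countType) (D0 : set T) (ops : I -> T -> T -> T) :
  countable D0 ->
  exists D, [/\ countable D, D0 `<=` D & forall i a b, D a -> D b -> D (ops i a b)].
Proof.
move=> cD0.
pose S := fix S n := if n is n'.+1 then
  S n' `|` [set ops p.1 p.2.1 p.2.2 | p in setT `*` (S n' `*` S n')] else D0.
have cS n : countable (S n).
  elim: n => [//|n IH] /=; rewrite -bigcup2E.
  apply: bigcup_countable => // -[|[|m]] _ //=.
  apply: (sub_countable (card_image_le _ _)).
  by apply: countableX; [exact: countableP|exact: countableX].
have Smono n m : (n <= m)%N -> S n `<=` S m.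
  move=> /subnK <-; elim: (m - n)%N => [//|i IH]; rewrite addSn /= => x Sx.
  by left; exact: IH.
exists (\bigcup_n S n); split.
- by apply: bigcup_countable.
- by move=> x D0x; exists 0%N.
- move=> i a b [n _ Sa] [m _ Sb]; exists (maxn n m).+1 => //=; right.
  exists (i, (a, b)) => //; split=> //; split=> /=.
    by apply: Smono Sa; exact: leq_maxl.
  by apply: Smono Sb; exact: leq_maxr.
Qed.

Section closed_subspace_theory.
Context {R : realType} {k : scalars} {X : normedModType (scalar_field R k)}.
Local Notation K := (scalar_field R k).

Lemma closed_subspace_of_closure (q : nat -> K) (D : set X) :
  (forall (z : K) (e : R), 0 < e -> exists n, re_part `|z - q n| < e) ->
  D !=set0 -> (forall a b, D a -> D b -> D (a + b)) ->
  (forall n a, D a -> D (q n *: a)) ->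
  exists U : closed_subspace X, (U : set X) = closure D.
Proof.
move=> qd [d0 Dd0] DD DZ.
have smul (z : K) (d : X) (e : R) : 0 < e -> exists n, nrm (z *: d - q n *: d) < e.
  move=> e0; have p : 0 < nrm d + 1 by have := nrm_ge0 d; lra.
  have [|n zn] := qd z (e / (nrm d + 1)); first by rewrite divr_gt0.
  exists n; rewrite -scalerBl nrmZ; move: zn; rewrite ltr_pdivlMr //.
  apply: le_lt_trans; rewrite ler_wpM2l //; last by lra.
  by rewrite -(scal_le (k := k)) rmorph0 -normc_scal.
suff sm : submod_closed (mem (closure D)).
  by exists (ClosedSubspace sm (@closed_closure _ D)).
split.
  apply/mem_set/closure_nrm => e /(smul 0 d0)[n H]; exists (q n *: d0); first exact: DZ.
  by move: H; rewrite scale0r.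
move=> a u v /set_mem/closure_nrm cu /set_mem/closure_nrm cv.
apply/mem_set/closure_nrm => e e0; have e3 : 0 < e / 3 by lra.
have na : 0 <= re_part `|a| by rewrite -(scal_le (k := k)) rmorph0 -normc_scal.
have a1 : 0 < re_part `|a| + 1 by lra.
(* Multiplication by [a] then costs at most [e / 3]; adding [1] avoids dividing by zero. *)
have [|d Dd ud] := cu (e / 3 / (re_part `|a| + 1)); first by rewrite divr_gt0.
have [n an] := smul a d _ e3.
have [d' Dd' vd'] := cv _ e3.
exists (q n *: d + d'); first by apply: DD => //; exact: DZ.
rewrite opprD addrACA (le_lt_trans (nrmD _ _)) //.
have : nrm (a *: u - a *: d) < e / 3.
  rewrite -scalerBr nrmZ; move: ud; rewrite ltr_pdivlMr //.
  by apply: le_lt_trans; rewrite mulrC ler_wpM2l ?nrm_ge0 //; lra.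
by have := nrm_dist (a *: d) (a *: u) (q n *: d); lra.
Qed.

Lemma subspace_typeP (U : closed_subspace X) x :
  (U : set X) x -> exists u : subspace_type U, val u = x.
Proof.
move=> Ux; have Ux' : x \in subspace_pred U by apply/mem_set.
by exists (SubspaceType Ux').
Qed.

Lemma subspace_valP (U : closed_subspace X) (u : subspace_type U) : (U : set X) (val u).
Proof. exact: set_mem (valP u). Qed.

Lemma separable_of_closure (U : closed_subspace X) (D : set X) :
  countable D -> (U : set X) = closure D -> separable_space (subspace_type U).
Proof.
move=> cD UD; exists [set u : subspace_type U | D (val u)].
  have /countable_injP[f finj] := cD; apply/countable_injP.
  exists (f \o val) => u v /set_mem Du /set_mem Dv /= fuv.
  by apply: val_inj; apply: finj fuv; exact: mem_set.
move=> O [u Ou] oO.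
have /nbhs_nrm[e e0 eO] : nbhs u O by apply: open_nbhs_nbhs.
have : closure D (val u) by rewrite -UD; exact: subspace_valP.
move=> /closure_nrm/(_ e e0)[d Dd ud].
have [w wd] : exists w : subspace_type U, val w = d.
  by apply: subspace_typeP; rewrite UD; exact: subset_closure.
exists w; split; last by rewrite /= wd.
apply: eO; change (nrm (val (u - w)) < e).
by rewrite raddfB /= wd.
Qed.

Lemma separable_countable_closure (U : closed_subspace X) :
  separable_space (subspace_type U) ->
  exists D, countable D /\ (U : set X) `<=` closure D.
Proof.
move=> [D cD dD]; exists (val @` D); split.
  exact: (sub_countable (card_image_le _ _)).
move=> x /subspace_typeP[u <-]; apply/closure_nrm => e e0.
have N : nbhs u [set w | nrm (u - w) < e] by apply/nbhs_nrm; exists e.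
have [|w [/interior_subset /= uw Dw]] := dD _ _ (open_interior [set w | nrm (u - w) < e]).
  by exists u.
exists (val w); first by exists w.
by rewrite -(raddfB val).
Qed.

Lemma separable_subspace_mem (x : X) : exists U : closed_subspace X,
  (U : set X) x /\ separable_space (subspace_type U).
Proof.
have [q qd] := dense_scalars (R := R) (k := k).
pose ops (n : nat) (a b : X) := if n is m.+1 then q m *: a else a + b.
have [D [cD xD opsD]] := countable_closure ops (countable1 x).
have Dx : D x by apply: xD.
have [||n a Da|U UD] := @closed_subspace_of_closure q D qd.
- by exists x; exact: Dx.
- by move=> a b; exact: (opsD 0%N).
- exact: (opsD n.+1 a a).
exists U; split; first by rewrite UD; exact: subset_closure.
exact: separable_of_closure UD.
Qed.

Lemma conv_hull_val (U : closed_subspace X) (F : set (subspace_type U)) :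
  conv_hull (val @` F) = val @` conv_hull F.
Proof.
apply/seteqP; split.
  apply: conv_hull_min; last first.
    by move=> _ [u Fu <-]; exists u => //; exact: sub_conv_hull.
  move=> _ _ t [u Fu <-] [v Fv <-] t0 t1.
  by exists (scal t *: u + scal (1 - t) *: v); first exact: conv_hull_convex.
move=> _ [u Fu <-]; move: u Fu; apply: conv_hull_min.
  by move=> u v t Fu Fv t0 t1; exact: conv_hull_convex Fu Fv t0 t1.
by move=> u Fu /=; apply: sub_conv_hull; exists u.
Qed.

Lemma aconv_val (U : closed_subspace X) (F : set (subspace_type U)) :
  aconv (val @` F) = val @` aconv F.
Proof.
rewrite /aconv -conv_hull_val; congr conv_hull; apply/seteqP; split.
  by move=> _ [w [_ [w1 [u Fu <-] ->]]]; exists (w *: u); first by exists w, u.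
by move=> _ [_ [w [u [w1 Fu ->]]] <-]; exists w, (val u); split=> //; exists u.
Qed.

End closed_subspace_theory.

(** * Passage between [G] and its restrictions to separable subspaces *)

Section lush_restriction.
Context {R : realType} {k : scalars} {X Y : normedModType (scalar_field R k)}.
Context (G : bounded_op X Y).
Local Notation K := (scalar_field R k).

Definition separably_lush := forall (X0 : closed_subspace X) (Y0 : closed_subspace Y),
  separable_space (subspace_type X0) -> separable_space (subspace_type Y0) ->
  exists (X1 : closed_subspace X) (Y1 : closed_subspace Y) (GXY : G @` X1 `<=` Y1),
    X0 `<=` X1 /\ separable_space (subspace_type X1) /\
    Y0 `<=` Y1 /\ separable_space (subspace_type Y1) /\
    opnorm (restrict_op GXY) = 1 /\ lush (restrict_op GXY).

Lemma lush_of_separably_lush : opnorm G = 1 -> separably_lush -> lush G.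
Proof.
move=> G1 sG; split=> // x0 e y x0B e0 y1.
have [X0 [X0x sX0]] := separable_subspace_mem x0.
have [Y0 [Y0y sY0]] := separable_subspace_mem y.
have [X1 [Y1 [GXY [XX1 [_ [YY1 [_ [_ [_ L]]]]]]]]] := sG _ _ sX0 sY0.
have [u ux] := subspace_typeP (XX1 _ X0x).
have [v vy] := subspace_typeP (YY1 _ Y0y).
have u1 : unit_ball (subspace_type X1) u.
  by apply/unit_ballE; move/unit_ballE : x0B; rewrite -ux.
have v1 : unit_sphere (subspace_type Y1) v.
  by apply/unit_sphereE; move/unit_sphereE : y1; rewrite -vy.
have [F [FB Fn /set_dist_lt[a Fa ua]]] := L u e v u1 e0 v1.
exists (val @` F); split.
- by move=> _ [w Fw <-]; apply/unit_ballE; exact: (proj1 (unit_ballE w) (FB _ Fw)).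
- rewrite conv_hull_val => _ [w Fw <-]; have [w1 wn] := Fn _ Fw.
  split; first by apply/unit_ballE; exact: (proj1 (unit_ballE w) w1).
  by rewrite -vy; exact: wn.
- apply/set_dist_lt; exists (val a); first by rewrite aconv_val; exists a.
  by rewrite -ux; exact: ua.
Qed.

(** The list depends only on [x], [y] and [d], not on the nearby [x0] and [y0], so countably many
    choices cover all pairs approximated by a countable set. Replacing [x0], [y0] by [x], [y] costs
    the second [d]. *)
Lemma lush_finite x y (d : R) : lush G -> 0 < d ->
  exists s : seq X,
    (exists x0 y0, [/\ nrm x0 <= 1, nrm y0 = 1, nrm (x - x0) < d & nrm (y - y0) < d]) ->
    [/\ forall a, a \in s -> nrm a <= 1,
        forall z, conv_hull [set` s] z -> nrm z <= 1 /\ 2 - 2 * d < nrm (G z + y) &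
        exists2 a, aconv [set` s] a & nrm (x - a) < 2 * d].
Proof.
move=> [_ L] d0.
have [[x0 [y0 [x01 y01 xx0 yy0]]]|nex] := pselect (exists x0 y0,
  [/\ nrm x0 <= 1, nrm y0 = 1, nrm (x - x0) < d & nrm (y - y0) < d]); last first.
  by exists [::] => /nex.
have [F [FB Fn /set_dist_lt[a /aconv_finite[s [sF sa]] xa]]] :=
  L x0 d y0 (proj2 (unit_ballE _) x01) d0 (proj2 (unit_sphereE _) y01).
exists s => _; split.
- by move=> b /sF /FB /unit_ballE.
- move=> z sz; have [|/unit_ballE z1 zn] := Fn z; first exact: conv_hull_mono sz.
  split=> //; have := nrmD (G z + y) (y0 - y).
  by rewrite addrCA addrK addrC [nrm (y0 - y)]nrmB; lra.
- by exists a => //; have := nrm_dist x0 x a; lra.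
Qed.

Lemma separably_lush_of_lush : lush G -> separably_lush.
Proof.
move=> LG X0 Y0 sX0 sY0; have [G1 _] := LG.
have [DX0 [cDX0 XD]] := separable_countable_closure sX0.
have [DY0 [cDY0 YD]] := separable_countable_closure sY0.
have [q qd] := dense_scalars (R := R) (k := k).
(* These vectors are put into the subspace so that the restriction keeps norm one. *)
have nearly n : exists x, nrm x <= 1 /\ 1 - n.+1%:R^-1 < nrm (G x).
  have [|x x1 xn] := @opnorm_gt R k X Y G (1 - n.+1%:R^-1).
    by rewrite G1 ltrBlDr ltrDl invr_gt0.
  by exists x.
have [xs xsP] := choice nearly.
have dn n : 0 < n.+1%:R^-1 :> R by rewrite invr_gt0.
have [s sP] := choice (fun p : X * Y * nat => lush_finite p.1.1 p.1.2 LG (dn p.2)).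
(* One countable set of pairs closes both sides together: sums, scalings, recombination of
   coordinates (making it a product), images under [G], and entries of the witness lists. *)
pose ops (i : nat * (nat * nat)) (a b : X * Y) : X * Y := match i.1 with
  | 0%N => (a.1 + b.1, a.2 + b.2)
  | 1%N => (q i.2.1 *: a.1, q i.2.1 *: a.2)
  | 2%N => (a.1, b.2)
  | 3%N => (a.1, G a.1)
  | _ => (nth 0 (s (a, i.2.1)) i.2.2, a.2)
  end.
have cD0 : countable ((DX0 `|` range xs) `*` DY0).
  apply: countableX => //; rewrite -bigcup2E.
  apply: bigcup_countable => // -[|[|m]] _ //=.
  exact: (sub_countable (card_image_le _ _)).
have [D [cD D0D opsD]] := countable_closure ops cD0.
pose DX := fst @` D; pose DY := snd @` D.
have DP x y : DX x -> DY y -> D (x, y).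
  move=> [[a1 a2] Da <-] [[b1 b2] Db <-].
  exact: (opsD (2, (0, 0))%N (a1, a2) (b1, b2) Da Db).
have D0X x : DX0 x \/ range xs x -> DX x.
  move=> x0; have : (Y0 : set Y) 0 by have [/set_mem] := subspace_submod Y0.
  move=> /YD/closure_nrm/(_ 1 ltr01)[y y0 _].
  by exists (x, y) => //; apply: D0D.
have D0Y y : DY0 y -> DY y.
  by move=> y0; exists (xs 0%N, y) => //; apply: D0D; split=> //; right; exists 0%N.
have DG x : DX x -> DY (G x).
  move=> [[a b] Da <-]; exists (a, G a) => //.
  exact: (opsD (3, (0, 0))%N (a, b) (a, b) Da Da).
have Ds x y m a : DX x -> DY y -> a \in s (x, y, m) -> DX a.
  move=> Dx Dy sa; have Dxy := DP _ _ Dx Dy.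
  exists (nth 0 (s (x, y, m)) (index a (s (x, y, m))), y); last by rewrite /= nth_index.
  exact: (opsD (4, (m, index a (s (x, y, m))))%N _ _ Dxy Dxy).
have [||n a [[u v] Du <-]|X1 X1E] := @closed_subspace_of_closure R k X q DX qd.
- by exists (xs 0%N); apply: D0X; right; exists 0%N.
- move=> a b [[a1 a2] Da <-] [[b1 b2] Db <-]; exists (a1 + b1, a2 + b2) => //.
  exact: (opsD (0, (0, 0))%N _ _ Da Db).
- exists (q n *: u, q n *: v) => //; exact: (opsD (1, (n, 0))%N _ _ Du Du).
have [||n a [[u v] Du <-]|Y1 Y1E] := @closed_subspace_of_closure R k Y q DY qd.
- by exists (G (xs 0%N)); apply/DG/D0X; right; exists 0%N.
- move=> a b [[a1 a2] Da <-] [[b1 b2] Db <-]; exists (a1 + b1, a2 + b2) => //.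
  exact: (opsD (0, (0, 0))%N _ _ Da Db).
- exists (q n *: u, q n *: v) => //; exact: (opsD (1, (n, 0))%N _ _ Du Du).
have G1' : opnorm G <= 1 by rewrite G1.
have GXY : G @` X1 `<=` Y1.
  rewrite X1E Y1E => _ [x /closure_nrm cx <-]; apply/closure_nrm => e /cx[d Dd xd].
  exists (G d); first exact: DG.
  by rewrite -linearB (le_lt_trans (opnorm_contraction _ G1')).
have N1 : opnorm (restrict_op GXY) = 1.
  apply/eqP; rewrite eq_le; apply/andP; split.
    apply: opnorm_le => u u1; change (nrm (G (val u)) <= 1).
    by rewrite (le_trans (opnorm_contraction _ G1')).
  rewrite leNgt; apply/negP; rewrite -subr_gt0 => lt1.
  pose c := 1 - opnorm (restrict_op GXY).
  pose n := Num.truncn c^-1.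
  have nc : n.+1%:R^-1 < c by rewrite invf_plt ?posrE // truncnS_gt.
  have [x1 xn] := xsP n.
  have [u ux] : exists u : subspace_type X1, val u = xs n.
    apply: subspace_typeP; rewrite X1E; apply: subset_closure; apply: D0X.
    by right; exists n.
  have u1 : nrm u <= 1 by change (nrm (val u) <= 1); rewrite ux.
  have := opnorm_ball (restrict_op GXY) u1.
  change (nrm (G (val u)) <= opnorm (restrict_op GXY) -> False).
  by rewrite ux; move: nc xn; rewrite /c; move: (n.+1%:R^-1) => r; lra.
exists X1, Y1, GXY; split; last split; last split; last split;
  last split=> //; last split=> //.
- move=> x /XD /closure_nrm cx; rewrite X1E; apply/closure_nrm => e /cx[d Dd xd].
  by exists d => //; apply: D0X; left.
- apply: separable_of_closure X1E.
  exact: (sub_countable (card_image_le _ _)).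
- move=> y /YD /closure_nrm cy; rewrite Y1E; apply/closure_nrm => e /cy[d Dd yd].
  by exists d => //; exact: D0Y.
- apply: separable_of_closure Y1E.
  exact: (sub_countable (card_image_le _ _)).
move=> u e v /unit_ballE u1 e0 /unit_sphereE v1.
(* [lush_finite] loses [2 * d], and passing from [x], [y] back to [u], [v] loses one more [d]. *)
have e3 : 0 < e / 3 by lra.
pose m := Num.truncn (e / 3)^-1.
have me : m.+1%:R^-1 < e / 3 by rewrite invf_plt ?posrE // truncnS_gt.
have m0 := dn m; set d := m.+1%:R^-1 in me m0.
have /closure_nrm/(_ d m0)[x Dx ux] : closure DX (val u).
  by rewrite -X1E; exact: subspace_valP.
have /closure_nrm/(_ d m0)[y Dy vy] : closure DY (val v).
  by rewrite -Y1E; exact: subspace_valP.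
have [|sB sn [a sa xa]] := sP (x, y, m).
  by exists (val u), (val v); split=> //; rewrite nrmB.
pose F := [set w : subspace_type X1 | val w \in s (x, y, m)].
have FE : [set` s (x, y, m)] = val @` F.
  apply/seteqP; split=> [b sb|_ [w Fw <-]//].
  have [w wb] : exists w : subspace_type X1, val w = b.
    by apply: subspace_typeP; rewrite X1E; apply: subset_closure; exact: Ds sb.
  by exists w => //; rewrite /F /= wb.
exists F; split.
- by move=> w /sB w1; apply/unit_ballE.
- move=> w Fw; have [|w1 wn] := sn (val w).
    by rewrite FE conv_hull_val; exists w.
  split; first exact/unit_ballE.
  change (2 - e < nrm (G (val w) + val v)).
  have := nrmD (G (val w) + val v) (y - val v).
  rewrite addrCA addrK addrC [nrm (y - _)]nrmB /=.
  by move: wn vy; rewrite /= -/d; lra.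
- move: sa; rewrite FE aconv_val => -[w Fw wa].
  apply/set_dist_lt; exists w => //; change (nrm (val u - val w) < e).
  have := nrm_dist x (val u) (val w); move: xa; rewrite -wa /= -/d; lra.
Qed.

End lush_restriction.

(** * The cycle of implications between the six conditions *)

Theorem proposition3p26 (R : realType) (k : scalars)
    (X Y : completeNormedModType (scalar_field R k))
    (A : set (dual Y)) (B : set X) (G : bounded_op X Y)
    (A_ball : A `<=` dual_ball Y)
    (A_hull : closure (conv_hull A : set (weak_star Y)) = dual_ball Y)
    (B_ball : B `<=` unit_ball X)
    (B_hull : closure (aconv B) = unit_ball X)
    (G_norm : opnorm G = 1) :
  [<->
    (* (i) *)
    lush G;
    (* (ii) *)
    forall (x0 : X) (y : Y) (e : R), B x0 -> unit_sphere Y y -> 0 < e ->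
      exists F : set X, [/\ F `<=` unit_ball X, conv_hull F `<=` near_max G y e &
                            (set_dist x0 (aconv F) < e%:E)%E];
    (* (iii) *)
    forall (x0 : X) (y : Y) (e : R), B x0 -> unit_sphere Y y -> 0 < e ->
      exists f : dual Y, [/\ A f, 1 - e < re_part (f y) &
                             (set_dist x0 (aconv (op_slice G f e)) < e%:E)%E];
    (* (iv) *)
    forall x0 : X, B x0 ->
      let E : set (set_type (extreme_points (dual_ball Y) : set (weak_star Y))) :=
        [set f | forall e : R, 0 < e ->
                   closure (aconv (op_slice G (set_val f) e)) x0] in
      dense E /\ Gdelta E;
    (* (v) *)
    forall (x0 : X) (y : Y) (e : R), B x0 -> unit_sphere Y y -> 0 < e ->
      exists f : dual Y, [/\ extreme_points (dual_ball Y) f, 1 - e < re_part (f y) &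
                             closure (aconv (op_slice G f e)) x0];
    (* (vi) *)
    forall (X0 : closed_subspace X) (Y0 : closed_subspace Y),
      separable_space (subspace_type X0) -> separable_space (subspace_type Y0) ->
      exists (X1 : closed_subspace X) (Y1 : closed_subspace Y)
             (GXY : G @` X1 `<=` Y1),
        X0 `<=` X1 /\ separable_space (subspace_type X1) /\
        Y0 `<=` Y1 /\ separable_space (subspace_type Y1) /\
        opnorm (restrict_op GXY) = 1 /\ lush (restrict_op GXY)
  ].
Proof.
have G1 : opnorm G <= 1 by rewrite G_norm.
have extB : extreme_points (dual_ball Y) `<=` dual_ball Y by move=> f [].
have next y (c : R) : c < nrm y ->
    exists2 f, extreme_points (dual_ball Y) f & c < re_part (f y).
  by move=> cy; have [f xf fy] := norming_extreme y; exists f => //; rewrite fy.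
have lushP := lush_points G_norm B_hull.
tfae.
- by move=> [_ L] x0 y e /B_ball x01 y1 e0; exact: L.
- move=> L x0 y e Bx y1 e0.
  apply: (lush_at_slice G1 A_ball (norming_of_hull A_hull)) => //.
    by move/unit_sphereE : y1 => ->.
  by move=> d d0; exact: L.
- move=> S x0 Bx; apply: lush_point_dense_Gdelta => // y e y1 e0.
  have e2 : 0 < e / 2 by lra.
  have [f [Af fy sf]] := S x0 y (e / 2) Bx y1 e2.
  by apply: slice_near_lush_at (A_ball _ Af) fy sf; lra.
- move=> D x0 y e Bx y1 e0; have [dE _] := D x0 Bx.
  (* Density is applied to the open slice given by [y], which contains an extreme functional
     attaining the norm of [y]. *)
  have [||v [/= ev Ev]] := dE
    [set v : set_type (extreme_points (dual_ball Y) : set (weak_star Y)) |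
      1 - e < re_part ((set_val v : dual Y) y)].
  + have [f xf fy] := norming_extreme y.
    exists (exist _ f (mem_set xf)) => /=; rewrite fy.
    by move/unit_sphereE : y1 => ->; lra.
  + exists [set f : weak_star Y | 1 - e < re_part (f y)] => //.
    apply: (open_comp (f := fun f : weak_star Y => re_part (f y) : R)
        (D := [set r | 1 - e < r])).
      by move=> f _; exact: re_eval_continuous.
    exact: open_gt.
  by exists (set_val v); split=> //; [apply: set_mem; exact: valP|exact: Ev].
(* The route from (v) to (vi) passes through lushness of [G] itself. *)
- move=> V; apply: separably_lush_of_lush; apply: lushP => x0 Bx.
  apply: closure_slice_lush_point => y e y1 e0.
  by have [f [xf fy cf]] := V x0 y e Bx y1 e0; exists f; split=> //; exact: extB.
- exact: lush_of_separably_lush.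
Qed.
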